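(* Let $m,n\ge 1$ and let $\mathbb{C}(x_i^j)$ be the field of rational functions in the $mn$ indeterminates $x_i^j$ ($i\in[m]$, $j\in[n]$). Let $M(\mathbf{x})=W(\mathbf{x}_1)\cdots W(\mathbf{x}_m)$ (an $n\times n$ matrix). (1) The non-trivial entries of $M(\mathbf{x})$ (i.e. those that are not identically $0$ or $1$) are algebraically independent over $\mathbb{C}$ and generate the subfield ${\rm Inv}_e\subset\mathbb{C}(x_i^j)$ of invariants of the geometric crystal operators $e_1,\dots,e_{m-1}$. (2) The non-trivial entries of $M(\mathbf{x})$ generate the subring ${\rm Inv}_e\cap\mathbb{C}[x_i^j]$ of polynomial invariants of the $e_i$.
   Context: For $\mathbf{x}=(x_i^j)_{i\in[m]}^{j\in[n]}$ an $m\times n$ matrix, write $\mathbf{x}_i=(x_i^1,\dots,x_i^n)$ for its $i$th row. For $u=(u^1,\dots,u^n)$, $v=(v^1,\dots,v^n)$, $c\in\mathbb{C}^*$ and $j\in[0,n]$ set $\sigma^j(u,v;c)=\sum_{r=1}^n c^{\mathbb{1}_{r\le j}}v^1\cdots v^{r-1}u^{r+1}\cdots u^n$. For $i\in[m-1]$ and $c\in\mathbb{C}^*$, the geometric crystal operator $e_i^c$ is the rational map on $m\times n$ matrices over $\mathbb{C}^*$ which leaves all rows other than $i,i+1$ unchanged and replaces $x_i^j$ by $\frac{\sigma^j(\mathbf{x}_i,\mathbf{x}_{i+1};c)}{\sigma^{j-1}(\mathbf{x}_i,\mathbf{x}_{i+1};c)}x_i^j$ and $x_{i+1}^j$ by $\frac{\sigma^{j-1}(\mathbf{x}_i,\mathbf{x}_{i+1};c)}{\sigma^{j}(\mathbf{x}_i,\mathbf{x}_{i+1};c)}x_{i+1}^j$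 for $j\in[n]$. ${\rm Inv}_e$ is the set of $f\in\mathbb{C}(x_i^j)$ with $f\circ e_i^c=f$ (as rational functions of $\mathbf{x}$ and $c$) for all $i\in[m-1]$. For $y_1,\dots,y_n\in\mathbb{C}^*$, $W(y_1,\dots,y_n)$ is the $n\times n$ matrix with $y_1,\dots,y_n$ on the main diagonal, $1$'s directly below the main diagonal, and $0$'s elsewhere. *)

(* Defs.v *)
From HB Require Import structures.
From mathcomp Require Import all_boot all_algebra.
From mathcomp Require Import mpoly.
From mathcomp Require Import complex.
From mathcomp Require Import Rstruct.

Set Implicit Arguments.
Unset Strict Implicit.
Unset Printing Implicit Defensive.

Import GRing.Theory.
Local Open Scope ring_scope.

Notation "x %:F" := (@FracField.tofrac _ x) : ring_scope.

Definition CC : fieldType := (Rdefinitions.R)[i].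

Definition Wmx (K : nzRingType) (n : nat) (y : 'I_n -> K) : 'M[K]_n :=
  \matrix_(a < n, b < n)
    (if a == b then y a else if val a == (val b).+1 then 1 else 0).

Definition Pol (m n : nat) := {mpoly CC[m * n]}.

Definition xvar (m n : nat) : 'M[Pol m n]_(m, n) :=
  \matrix_(i < m, j < n) 'X_(mxvec_index i j).

Definition Mx (m n : nat) : 'M[Pol m n]_n :=
  foldr (fun A B => A *m B) 1%:M
        [seq Wmx (fun j => xvar m n i j) | i <- enum 'I_m].

Definition nontriv (m n : nat) : seq ('I_n * 'I_n) :=
  [seq ab <- [seq (a, b) | a <- enum 'I_n, b <- enum 'I_n]
     | (Mx m n ab.1 ab.2 != 0) && (Mx m n ab.1 ab.2 != 1)].

Definition gfam (m n : nat) (k : 'I_(size (nontriv m n))) : Pol m n :=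
  let ab := tnth (in_tuple (nontriv m n)) k in Mx m n ab.1 ab.2.

Definition evg (m n : nat) (A : {mpoly CC[size (nontriv m n)]}) : Pol m n :=
  mmap (fun c : CC => c%:MP) (@gfam m n) A.

Definition gfam_alg_indep (m n : nat) : Prop :=
  forall A : {mpoly CC[size (nontriv m n)]}, A != 0 -> evg A != 0.

Definition in_gen_field (m n : nat) (f : {fraction Pol m n}) : Prop :=
  exists A B : {mpoly CC[size (nontriv m n)]},
    evg B != 0 /\ f = (evg A)%:F / (evg B)%:F.

Definition in_gen_ring (m n : nat) (p : Pol m n) : Prop :=
  exists A : {mpoly CC[size (nontriv m n)]}, p = evg A.

(* sigma^j(u,v;c) = sum_{r=1}^n c^{[r<=j]} v^1..v^{r-1} u^{r+1}..u^n,
   written 0-based (r' = r-1). *)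
Definition sigma (K : nzRingType) (n : nat) (u v : 'I_n -> K) (c : K)
    (j : nat) : K :=
  \sum_(r < n) ((if (val r < j)%N then c else 1)
                * (\prod_(s < n | (val s < val r)%N) v s)
                * (\prod_(s < n | (val r < val s)%N) u s)).

(* e_i^c acting on an m x n matrix over a field K; i' is the row i+1.
   Column b (0-based) corresponds to j = b+1. *)
Definition ecrys (K : fieldType) (m n : nat) (i i' : 'I_m) (c : K)
    (X : 'M[K]_(m, n)) : 'M[K]_(m, n) :=
  let u := fun j => X i j in
  let v := fun j => X i' j in
  \matrix_(a < m, b < n)
    (if a == i then sigma u v c (val b).+1 / sigma u v c (val b) * X a b
     else if a == i' then sigma u v c (val b) / sigma u v c (val b).+1 * X a b
     else X a b).

Definition PolC (m n : nat) := {mpoly CC[(m * n).+1]}.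
Definition RatC (m n : nat) := {fraction PolC m n}.

Definition cvar (m n : nat) : RatC m n := ('X_(@ord_max (m * n)))%:F.

Definition xvarC (m n : nat) : 'M[RatC m n]_(m, n) :=
  \matrix_(i < m, j < n) ('X_(widen_ord (leqnSn _) (mxvec_index i j)))%:F.

Definition evC (m n : nat) (X : 'M[RatC m n]_(m, n)) (p : Pol m n)
  : RatC m n :=
  mmap (fun a : CC => (a%:MP : PolC m n)%:F) (fun k => mxvec X 0 k) p.

(* f o e_i^c = f as rational functions of x and c, for f = p/q *)
Definition inv_under (m n : nat) (i i' : 'I_m) (f : {fraction Pol m n})
  : Prop :=
  let E := ecrys i i' (cvar m n) (xvarC m n) in
  exists p q : Pol m n,
    [/\ q != 0, f = p%:F / q%:F, evC E q != 0 &
        evC E p / evC E q = evC (xvarC m n) p / evC (xvarC m n) q].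

Definition Inv_e (m n : nat) (f : {fraction Pol m n}) : Prop :=
  forall i i' : 'I_m, val i' = (val i).+1 -> inv_under i i' f.

(* Main.v *)
(** Write M = W(x_1) M'. A null vector g of M with nonzero entries gives a
left factor W(y), y_a = - g_(a+1) / g_a, and over an infinite field every
lower triangular banded matrix with nonzero diagonal is obtained from W's in
this way. If g' is another null vector, then its Darboux transform
h_a = - (g'_a y_a + g'_(a+1)) is a null vector of M', and for the first two
rows y and - h_(a+1) / h_a the parameter c = (g'_n / g_n) / (g'_0 / g_0) makes
sigma^j proportional to g'_j / g_j, so that e_1^c moves the first row to the
one given by g'. Thus an invariant which is a rational function of x_1 and M
does not change when g is replaced by a null vector with constant initial
values, hence depends on M only; descending induction on the number of rows
shows Inv_e = C(M).

For a degree-lexicographic order the leading monomial of M_(a, a-d) is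
x_1^a ... x_(m-d)^a. These are multiplicatively independent, which gives
algebraic independence. If f is polynomial and f B(M) = A(M), the leading
monomial of f is a product of integer powers of these monomials. The exponent
of M_(a, a) is nonnegative because x_m^a occurs in no other leading monomial;
that of another entry T_k is nonnegative because the denominator of f is free
of T_k: at a root of an irreducible factor of the denominator, the generic
matrix still factors into W's, so the factor divides the numerator. Subtracting
a monomial in the entries of M then lowers the leading monomial of f. *)
Require Import Defs.
From HB Require Import structures.
From mathcomp Require Import all_boot all_order all_algebra all_field.
From mathcomp Require Import mpoly.
From mathcomp Require Import complex.
From mathcomp Require Import Rstruct.
From mathcomp Require Import ring zify.
From Stdlib Require Import Classical.

Set Implicit Arguments.
Unset Strict Implicit.
Unset Printing Implicit Defensive.

Import Order.Theory GRing.Theory.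
Local Open Scope ring_scope.

(** * Left factors of banded matrices *)

Definition Wrow (R : nzRingType) n (y : 'rV[R]_n) : 'M[R]_n :=
  Wmx (fun j => y 0 j).

Definition Wprod (R : nzRingType) n (s : seq 'rV[R]_n) : 'M[R]_n :=
  foldr (fun y A => Wrow y *m A) 1%:M s.

(** The shape common to all products of [m] factors [W(y)]; for [m >= n] the subdiagonal of ones
    lies outside the matrix. *)
Definition band (R : nzRingType) n m (T : 'M[R]_n) : Prop :=
  forall a b : 'I_n,
  [/\ (a < b)%N -> T a b = 0, a = (b + m)%N :> nat -> T a b = 1
    & (b + m < a)%N -> T a b = 0].

Section Band.
Variables (R : nzRingType) (n m : nat) (T : 'M[R]_n).
Hypothesis bT : band m T.

Lemma band_lt (a b : 'I_n) : (a < b)%N -> T a b = 0.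
Proof. by case: (bT a b). Qed.

Lemma band_eq (a b : 'I_n) : a = (b + m)%N :> nat -> T a b = 1.
Proof. by case: (bT a b). Qed.

Lemma band_gt (a b : 'I_n) : (b + m < a)%N -> T a b = 0.
Proof. by case: (bT a b). Qed.

End Band.

Section Ring.
Variables (R : comNzRingType) (n : nat).
Implicit Types (T A : 'M[R]_n.+1) (g s : nat -> R) (y : 'rV[R]_n.+1).

Lemma inord_eq (k : nat) (a : 'I_n.+1) : k = a :> nat -> inord k = a.
Proof. by move=> ->; rewrite inord_val. Qed.

Lemma Wrow_mulE y A a b :
  (Wrow y *m A) a b
    = y 0 a * A a b + (if val a is a'.+1 then A (inord a') b else 0).
Proof.
rewrite mxE (bigD1 a) //= !mxE eqxx; congr (_ + _).
case Ea: (val a) => [|a'].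
  rewrite big1 // => k ka; rewrite mxE eq_sym (negPf ka) Ea.
  by rewrite mul0r.
have a'n : (a' < n.+1)%N by rewrite -Ea ltnW ?ltn_ord.
have ia : inord a' != a by rewrite -val_eqE /= inordK // Ea ltn_eqF.
rewrite (bigD1 (inord a')) //= mxE eq_sym (negPf ia) /= inordK //.
rewrite Ea eqxx mul1r big1 ?addr0 // => k /andP[ka kb].
rewrite mxE eq_sym (negPf ka) Ea eqSS; case: eqP => [e|_]; last by rewrite mul0r.
by case/negP: kb; apply/eqP; rewrite (inord_eq e).
Qed.

Lemma Wprod_cons y (s : seq 'rV[R]_n.+1) : Wprod (y :: s) = Wrow y *m Wprod s.
Proof. by []. Qed.

Lemma Wprod_band (s : seq 'rV[R]_n.+1) : band (size s) (Wprod s).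
Proof.
elim: s => [|y s IH] a b.
  rewrite addn0 /Wprod /= mxE; split.
  - by move=> ab; rewrite (_ : (a == b) = false) // -val_eqE ltn_eqF.
  - by move=> /val_inj ->; rewrite eqxx.
  - by move=> ab; rewrite (_ : (a == b) = false) // -val_eqE gtn_eqF.
rewrite Wprod_cons Wrow_mulE /=; have [I1 I2 I3] := IH a b.
case Ea: (val a) => [|a'].
  have {}Ea : a = 0%N :> nat by [].
  rewrite addr0 addnS; split=> ab; first by rewrite I1 ?Ea ?mulr0.
    by [].
  by [].
have a'n : (a' < n.+1)%N by rewrite -Ea ltnW ?ltn_ord.
have {}Ea : a = a'.+1 :> nat by [].
have [J1 J2 J3] := IH (inord a') b; rewrite inordK // in J1 J2 J3.
split=> ab.
- rewrite J1 ?I1 ?Ea ?mulr0 ?addr0 //; exact: leq_trans ab.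
- move: ab; rewrite addnS => -[ab].
  by rewrite I3 ?J2 ?mulr0 ?add0r // Ea ab.
- move: ab; rewrite addnS ltnS => ab.
  by rewrite I3 ?J3 ?mulr0 ?addr0 // Ea ltnS ltnW.
Qed.

Lemma Wprod_diag (s : seq 'rV[R]_n.+1) a : Wprod s a a = \prod_(y <- s) y 0 a.
Proof.
elim: s => [|y s IH]; first by rewrite big_nil mxE eqxx.
rewrite big_cons Wprod_cons Wrow_mulE IH /=; case Ea: (val a) => [|a']; first by rewrite addr0.
have a'n : (a' < n.+1)%N by rewrite -Ea ltnW ?ltn_ord.
have lt_a'a : ((inord a' : 'I_n.+1) < a)%N.
  by rewrite inordK // -[X in (_ < X)%N]/(val a) Ea.
by rewrite (band_lt (@Wprod_band s)) // addr0.
Qed.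

(** Row [k] of [A] enters row [k] of the product with factor [y_k] and row [k.+1] with factor 1.
    Collecting by rows of [A] leaves a boundary term, because row [j] of the product is not
    summed. *)
Lemma sum_Wrow_by_parts y A g b j : (j <= n.+1)%N ->
  \sum_(k < j) g k * (Wrow y *m A) (inord k) b
  = \sum_(k < j) (g k * y 0 (inord k) + g k.+1) * A (inord k) b
    - (if j is j'.+1 then g j * A (inord j') b else 0).
Proof.
elim: j => [|j IH] jn; first by rewrite !big_ord0 subr0.
rewrite !big_ord_recr /= IH 1?ltnW // Wrow_mulE /= inordK //.
case: j IH jn => [|j] IH jn /=; ring.
Qed.

(** In a banded [T] the column [b] ends with the entry 1 at row [b + m], which is written as the
    separate term [g (b + m)]; for [b + m = n.+1] this row lies just outside [T]. So [g] is used at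
    the indices [0] to [n.+1], one more than the number of rows. *)
Definition null m T g : Prop :=
  forall b : 'I_n.+1, (b + m <= n.+1)%N ->
  \sum_(k < b + m) g k * T (inord k) b + g (b + m)%N = 0.

(** Summation by parts turns the relations for [g] into relations for its Darboux transform. These
    are the null relations of [A] with [b + m <= n]; the one with [b + m = n.+1] would involve entry
    [n.+1] of the transform, which depends on a value of [g] beyond [n.+1]. *)
Lemma null_Wrow_mul m y A g : band m A ->
  null m.+1 (Wrow y *m A) g <->
  (forall b : 'I_n.+1, (b + m < n.+1)%N ->
   \sum_(k < b + m) (- (g k * y 0 (inord k) + g k.+1)) * A (inord k) b
   - (g (b + m)%N * y 0 (inord (b + m)) + g (b + m).+1) = 0).
Proof.
move=> bA.
suff E (b : 'I_n.+1) : (b + m < n.+1)%N ->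
   \sum_(k < b + m.+1) g k * (Wrow y *m A) (inord k) b + g (b + m.+1)%N
   = - (\sum_(k < b + m) (- (g k * y 0 (inord k) + g k.+1)) * A (inord k) b
   - (g (b + m)%N * y 0 (inord (b + m)) + g (b + m).+1)).
  split=> H b bm.
    by apply/eqP; rewrite -oppr_eq0 -E // H // addnS.
  by rewrite addnS in bm; rewrite E // H // oppr0.
move=> bm; rewrite addnS sum_Wrow_by_parts // big_ord_recr /=.
rewrite (band_eq bA) ?inordK //.
under [X in _ = - (X - _)]eq_bigr do rewrite mulNr.
rewrite sumrN; ring.
Qed.

(* The first [m] entries of a null vector are free and determine the others. *)
Fixpoint gseq m T s j : seq R :=
  if j is j'.+1 then
    let l := gseq m T s j' in
    rcons l (if (j' < m)%N then s j'
             else - \sum_(k < j') l`_k * T (inord k) (inord (j' - m)))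
  else [::].

Definition gext m T s j : R := (gseq m T s j.+1)`_j.

Lemma size_gseq m T s j : size (gseq m T s j) = j.
Proof. by elim: j => //= j IH; rewrite size_rcons IH. Qed.

Lemma nth_gseq m T s j k : (k < j)%N -> (gseq m T s j)`_k = gext m T s k.
Proof.
elim: j => // j IH; rewrite ltnS leq_eqVlt => /predU1P[->|kj] //.
by rewrite /= nth_rcons size_gseq kj IH.
Qed.

Lemma gextE m T s j : gext m T s j =
  if (j < m)%N then s j
  else - \sum_(k < j) gext m T s k * T (inord k) (inord (j - m)).
Proof.
rewrite {1}/gext /= nth_rcons size_gseq ltnn eqxx; case: ifP => // _.
by congr (- _); apply: eq_bigr => k _; rewrite nth_gseq.
Qed.

Lemma gext_null m T s : null m T (gext m T s).
Proof.
move=> b bm; rewrite [X in _ + X]gextE ltnNge leq_addl /= addnK inord_val.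
by rewrite addrN.
Qed.

(** Each relation expresses entry [b + m] by earlier ones, so both sequences obey the same
    recursion. The bound [N] admits vectors known to satisfy only the first relations, such as a
    Darboux transform. *)
Lemma null_gext_upto N m T g j : (0 < m)%N -> (N <= n.+1)%N ->
  (forall b : 'I_n.+1, (b + m <= N)%N ->
     \sum_(k < b + m) g k * T (inord k) b + g (b + m)%N = 0) ->
  (j <= N)%N -> gext m T g j = g j.
Proof.
move=> m0 Nn ng; elim/ltn_ind: j => j IH jN; rewrite gextE; case: ltnP => // mj.
have e : (inord (j - m) : 'I_n.+1) = (j - m)%N :> nat.
  rewrite inordK // ltn_subLR // (leq_trans _ (leq_add m0 (leqnn _))) //.
  exact: leq_trans jN Nn.
have := ng (inord (j - m)); rewrite e subnK // => /(_ jN)/eqP.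
rewrite addr_eq0 => /eqP E; apply: oppr_inj; rewrite opprK -E.
apply: eq_bigr => k _; rewrite IH //; exact: leq_trans (ltnW (ltn_ord k)) jN.
Qed.

Lemma null_gext m T g j : (0 < m)%N -> null m T g -> (j <= n.+1)%N ->
  gext m T g j = g j.
Proof. by move=> m0 ng; apply: null_gext_upto. Qed.

Lemma eq_gext m T s s' : (forall j, (j < m)%N -> s j = s' j) ->
  gext m T s =1 gext m T s'.
Proof.
move=> ss j; elim/ltn_ind: j => j IH; rewrite !gextE; case: ltnP => [/ss //|_].
by congr (- _); apply: eq_bigr => k _; rewrite IH.
Qed.

End Ring.

Lemma rmorph_gext (R S : comNzRingType) (f : {rmorphism R -> S}) n m
    (T : 'M[R]_n.+1) s j :
  f (gext m T s j) = gext m (map_mx f T) (f \o s) j.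
Proof.
elim/ltn_ind: j => j IH; rewrite !gextE; case: ltnP => //= _.
rewrite rmorphN rmorph_sum; congr (- _); apply: eq_bigr => k _.
by rewrite rmorphM IH // mxE.
Qed.

(* A vector g annihilating T (the last relation involves a fictitious row n+1 of
   T) splits off a left factor W(y), where y_a = - g_(a+1) / g_a. *)
Section Peel.
Variables (L : fieldType) (n : nat).
Implicit Types (T A : 'M[L]_n.+1) (g s : nat -> L) (y : 'rV[L]_n.+1).

Definition yrow g : 'rV[L]_n.+1 := \row_a (- (g a.+1 / g a)).

(** The right factor, found by solving [Wrow (yrow g) *m A = T] for [A]: since
    [g k * y_k + g k.+1 = 0], summation by parts leaves only the boundary term [- g a.+1] times row
    [a] of [A]. *)
Definition peel T g : 'M[L]_n.+1 :=
  \matrix_(a, b) (- (g a.+1)^-1 * \sum_(k < a.+1) g k * T (inord k) b).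

Definition nonzero g := forall j, (j <= n.+1)%N -> g j != 0.

Lemma peelK T g : nonzero g -> Wrow (yrow g) *m peel T g = T.
Proof.
move=> g0; apply/matrixP => a b; rewrite Wrow_mulE !mxE big_ord_recr /=.
rewrite inord_val.
have h1 := g0 _ (ltn_ord a); have h2 := g0 _ (ltnW (ltn_ord a)).
case Ea: (val a) => [|a'].
  by rewrite big_ord0 add0r addr0 -Ea; field; apply/andP.
rewrite mxE inordK; last by rewrite -Ea ltnW ?ltn_ord.
by rewrite -Ea; field; apply/andP.
Qed.

Lemma peel_Wrow A g : nonzero g -> peel (Wrow (yrow g) *m A) g = A.
Proof.
move=> g0; apply/matrixP => a b; rewrite mxE sum_Wrow_by_parts // big1 => [|k _].
  by rewrite sub0r inord_val mulrNN mulKf // g0.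
rewrite mxE inordK; last exact: leq_trans (ltn_ord k) (ltn_ord a).
have h2 : g k != 0.
  by apply: g0; rewrite (leq_trans (ltnW (ltn_ord k)) (ltn_ord a)).
by rewrite mulrN mulrCA mulfV // mulr1 addNr mul0r.
Qed.

(** The null relation of column [b] gives the partial sum through row [b + m] the value
    [- g (b + m).+1], hence the entry 1. Adding row [b + m.+1], where [T] is 1, makes the sum zero,
    and it stays zero further down. *)
Lemma peel_band m T g : band m.+1 T -> null m.+1 T g -> nonzero g ->
  band m (peel T g).
Proof.
move=> bT nT g0 a b; split=> ab; rewrite mxE.
- rewrite big1 ?mulr0 // => k _; rewrite (band_lt bT) ?mulr0 //.
  rewrite inordK; first exact: leq_trans (ltn_ord k) ab.
  exact: leq_trans (ltn_ord k) (ltn_ord a).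
- have := nT b; rewrite addnS -ab ltn_ord => /(_ isT)/eqP.
  by rewrite addr_eq0 => /eqP ->; rewrite mulrNN mulVf // g0.
- have S0 (j : nat) : (b + m < j < n.+1)%N ->
      \sum_(k < j.+1) g k * T (inord k) b = 0.
    elim: j => // j IH; rewrite ltnS leq_eqVlt andb_orl.
    case/orP=> [/andP[/eqP jE jn]|jn].
      rewrite big_ord_recr /= -jE; rewrite (band_eq bT) ?inordK ?addnS // ?jE //.
      by rewrite mulr1 -jE -addnS nT // addnS jE ltnW.
    rewrite big_ord_recr /= IH; last by case/andP: jn => -> /ltnW.
    rewrite (band_gt bT) ?mulr0 ?addr0 //.
    by case/andP: jn => h1 h2; rewrite inordK // addnS ltnS.
  by rewrite S0 ?mulr0 // ab ltn_ord.
Qed.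

Lemma peel_diag m T g a : band m T -> nonzero g -> T a a != 0 ->
  peel T g a a != 0.
Proof.
move=> bT g0 Ta; rewrite mxE big_ord_recr /= big1 => [|k _].
  rewrite add0r inord_val !mulf_neq0 // ?oppr_eq0 ?invr_eq0 ?g0 //.
  exact: ltnW.
rewrite (band_lt bT) ?mulr0 //.
by rewrite inordK // (leq_trans (ltn_ord k)) // ltnW.
Qed.

(* As T has nonzero diagonal, a null vector can also be continued backwards. *)
Lemma null_window m T : (forall a, T a a != 0) -> band m T -> (0 < m)%N ->
  forall b, (b + m <= n.+2)%N -> forall w : nat -> L,
  exists2 g, null m T g & forall k, (b <= k < b + m)%N -> g k = w k.
Proof.
move=> T0 bT m0; elim=> [|b IH] bm w.
  exists (gext m T w); first exact: gext_null.
  by move=> k /andP[_ km]; rewrite gextE km.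
have bn : (b + m <= n.+1)%N by [].
have bn' : (b < n.+1)%N by rewrite (leq_trans _ bn) // -addn1 leq_add2l.
pose S := \sum_(k < b + m | (b < k)%N) w k * T (inord k) (inord b).
(* [w'] prescribes at [b] the value which, through the relation of column [b], forces entry [b + m]
   to be [w (b + m)]; solving for it divides by the diagonal entry of [T]. *)
pose w' k := if k == b then - (S + w (b + m)%N) / T (inord b) (inord b) else w k.
have [|g ng gw] := IH _ w'; first by rewrite ltnW.
exists g => // k /andP[bk]; rewrite addSn ltnS leq_eqVlt => /predU1P[->|kb].
  have := ng (inord b); rewrite inordK // => /(_ bn)/eqP.
  rewrite addrC addr_eq0 => /eqP ->.
  have bbm : (b < b + m)%N by rewrite -[X in (X < _)%N]addn0 ltn_add2l.
  rewrite (bigD1 (Ordinal bbm)) //= gw ?leqnn // /w' eqxx divfK //.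
  rewrite (bigID (fun k : 'I_(b + m) => (b < k)%N)) /=.
  rewrite [X in _ + (_ + X)]big1 => [|i /andP[ib]]; last first.
    rewrite -leqNgt => bi; rewrite (band_lt bT) ?mulr0 //.
    rewrite !inordK //; last exact: leq_trans bn.
    by rewrite ltn_neqAle bi andbT.
  rewrite (eq_big (fun i : 'I_(b + m) => (b < i)%N)
     (fun i : 'I_(b + m) => w i * T (inord i) (inord b))) => [|i|i].
  - by rewrite -/S; ring.
  - rewrite -val_eqE /= andbC; case: ltnP => //= bi; rewrite gtn_eqF //.
  - by case/andP=> _ bi; rewrite gw ?ltn_ord 1?ltnW // /w' gtn_eqF.
by rewrite gw ?kb 1?ltnW // /w' gtn_eqF.
Qed.

Lemma null_neq0 m T j : (forall a, T a a != 0) -> band m T -> (0 < m)%N ->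
  (j <= n.+1)%N -> exists2 g, null m T g & g j != 0.
Proof.
move=> T0 bT m0 jn; case: (ltnP j m) => jm.
  exists (gext m T (fun=> 1)); first exact: gext_null.
  by rewrite gextE jm oner_neq0.
have [|g ng gw] := @null_window m T T0 bT m0 (j.+1 - m) _ (fun=> 1).
  by rewrite subnK // ltnW.
exists g => //; rewrite gw ?oner_neq0 // subnK ?ltnSn ?andbT; last exact: ltnW.
by rewrite leq_subLR -addn1 addnC leq_add2r.
Qed.

End Peel.

(** * Nonvanishing of polynomials at points of an infinite field *)

Definition infinite_ring (K : nzRingType) := exists f : nat -> K, injective f.

Lemma infinite_rmorph (K L : fieldType) (f : {rmorphism K -> L}) :
  infinite_ring K -> infinite_ring L.
Proof. by case=> e ie; exists (f \o e) => a b /fmorph_inj/ie. Qed.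

(** The leading monomial of [P] splits into a power of the last variable and a monomial in the
    others. No other monomial of the support splits in the same way, so its coefficient survives. *)
Lemma muni_neq0 (R : nzRingType) k (P : {mpoly R[k.+1]}) :
  P != 0 -> muni P != 0.
Proof.
move=> P0; pose m0 := mlead P.
apply/eqP => /(congr1 (fun q : {poly {mpoly R[k]}} =>
  (q`_(m0 ord_max))@_[multinom m0 (widen_ord (leqnSn k) i) | i < k])).
rewrite coef0 mcoeff0 muniE coef_sum raddf_sum /=.
rewrite (bigD1_seq m0) ?msupp_uniq ?mlead_supp //= big1_seq => [|m /andP[mm _]].
  rewrite addr0 !coefZ coefXn eqxx mulr1 mcoeffZ mcoeffX eqxx mulr1.
  by move/eqP; rewrite mleadc_eq0 (negPf P0).
rewrite !coefZ coefXn; case: eqP => [e0|_]; last by rewrite mulr0 mcoeff0.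
rewrite mulr1 mcoeffZ mcoeffX; case: eqP => [e1|]; last by rewrite mulr0.
case/eqP: mm; apply/mnmP => i; have [->//|im] := eqVneq i ord_max.
have ik : (i < k)%N by rewrite ltn_neqAle -(inj_eq val_inj) in im *; rewrite im -ltnS ltn_ord.
move/mnmP/(_ (Ordinal ik)): e1; rewrite !mnmE.
by rewrite (_ : widen_ord _ _ = i) //; apply: val_inj.
Qed.

Lemma horner_muni (R : comNzRingType) k (P : {mpoly R[k.+1]}) (v : 'I_k.+1 -> R) :
  (map_poly (meval (fun i => v (widen_ord (leqnSn k) i))) (muni P)).[v ord_max]
  = P.@[v].
Proof.
rewrite muniE rmorph_sum horner_sum mevalE; apply: eq_bigr => m _ /=.
rewrite -!mul_polyC -mul_mpolyC !rmorphM /= map_polyXn !map_polyC /=.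
rewrite !hornerM !hornerC hornerXn mevalC mevalX big_ord_recr /= -mulrA.
by congr (_ * (_ * _)); apply: eq_bigr => i _; rewrite mnmE.
Qed.

(** The coefficients lie in [L] but the point is found in the smaller field [K]: this is what allows
    the initial values of a null vector to be constants. By induction on the variables, the leading
    coefficient in the last one is kept nonzero. *)
Lemma mpoly_nonroot (K L : fieldType) (f : {rmorphism K -> L}) k
    (P : {mpoly L[k]}) :
  infinite_ring K -> P != 0 -> exists v : 'I_k -> K, P.@[f \o v] != 0.
Proof.
move=> [e ie]; elim: k P => [|k IH] P P0.
  exists (fun=> 0); rewrite (nvar0_mpolyC P) mevalC.
  by apply: contra P0 => /eqP P0; rewrite (nvar0_mpolyC P) P0 mpolyC0.
have := muni_neq0 P0; rewrite -lead_coef_eq0 => /IH[v v0].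
pose q := map_poly (meval (f \o v)) (muni P).
have q0 : q != 0.
  apply/eqP => /(congr1 (fun q : {poly L} => q`_(size (muni P)).-1)).
  by rewrite coef0 coef_map /=; apply/eqP.
have [i ri] : exists i, ~~ root q (f (e i)).
  suff : has (fun c => ~~ root q c) [seq f (e i) | i <- iota 0 (size q)].
    by case/hasP => _ /mapP[i _ ->]; exists i.
  rewrite has_predC; apply/negP => /max_poly_roots - /(_ q0).
  rewrite size_map size_iota ltnn map_inj_uniq ?iota_uniq; first by move=> /(_ isT).
  by move=> a b /fmorph_inj/ie.
exists (fun j => if unlift ord_max j is Some j' then v j' else e i).
rewrite -horner_muni /= unlift_none.
rewrite (eq_map_poly (g := meval (f \o v))) // => p.
apply: meval_eq => j /=; rewrite (_ : widen_ord _ _ = lift ord_max j) ?liftK //.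
by apply: val_inj; rewrite /= /bump leqNgt ltn_ord.
Qed.

Section Factor.
Variables (L : fieldType) (n : nat).

(** The null vector with indeterminate initial values; having nonzero entries becomes the
    nonvanishing of polynomials in these values. *)
Definition gen_gext m (T : 'M[L]_n.+1) j : {mpoly L[m.+1]} :=
  gext m.+1 (map_mx (@mpolyC _ L) T) (fun k => 'X_(inord k)) j.

Lemma meval_gen_gext m (T : 'M[L]_n.+1) j (v : 'I_m.+1 -> L) :
  (gen_gext m T j).@[v] = gext m.+1 T (fun k => v (inord k)) j.
Proof.
rewrite /gen_gext rmorph_gext -map_mx_comp map_mx_id => [|a]; last exact: mevalC.
by apply: eq_gext => k _; rewrite /= mevalXU.
Qed.

Lemma meval_gen_gext_null m (T : 'M[L]_n.+1) j g :
  null m.+1 T g -> (j <= n.+1)%N ->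
  (gen_gext m T j).@[fun i : 'I_m.+1 => g i] = g j.
Proof.
move=> ng jn; rewrite meval_gen_gext -[RHS](@null_gext _ _ m.+1 T) //.
by apply: eq_gext => k km; rewrite inordK.
Qed.

Lemma gen_gext_neq0 m (T : 'M[L]_n.+1) j :
  band m.+1 T -> (forall a, T a a != 0) -> (j <= n.+1)%N -> gen_gext m T j != 0.
Proof.
move=> bT T0 jn; have [g ng gj] := null_neq0 T0 bT (ltn0Sn m) jn.
by apply: contra gj => /eqP e; rewrite -(meval_gen_gext_null ng) // e meval0.
Qed.

(** Each entry of the generic null vector is a nonzero polynomial in the initial values, so over an
    infinite field some null vector has no zero entry. It splits off one factor and lowers the band
    by one. *)
Lemma factor_band (f : infinite_ring L) m (T : 'M[L]_n.+1) :
  band m T -> (forall a, T a a != 0) ->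
  exists s : seq 'rV[L]_n.+1, [/\ size s = m,
    forall y a, y \in s -> y 0 a != 0 & Wprod s = T].
Proof.
elim: m T => [|m IH] T bT T0.
  exists [::]; split=> //; apply/matrixP => a b; rewrite /Wprod /= mxE.
  have [<-|ab] := eqVneq a b; first by rewrite (band_eq bT) // addn0.
  move: ab; rewrite -val_eqE neq_ltn => /orP[ab|ab].
    by rewrite (band_lt bT).
  by rewrite (band_gt bT) // addn0.
have P0 : \prod_(j < n.+2) gen_gext m T j != 0.
  by apply/prodf_neq0 => j _; apply: gen_gext_neq0; rewrite // -ltnS.
have [v] := @mpoly_nonroot L L idfun _ _ f P0.
rewrite rmorph_prod /= => /prodf_neq0 v0.
pose g := gext m.+1 T (fun k => v (inord k)).
have g0 : nonzero n g.
  by move=> j jn; rewrite /g -meval_gen_gext; apply: (v0 (Ordinal (jn : j < n.+2)%N)).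
have ng : null m.+1 T g by apply: gext_null.
have [a|s [ss s0 sT]] := IH _ (peel_band bT ng g0).
  exact: peel_diag bT g0 (T0 a).
exists (yrow n g :: s); split; rewrite ?Wprod_cons ?sT ?peelK //= ?ss //.
move=> y a; rewrite inE => /predU1P[->|]; last exact: s0.
rewrite mxE oppr_eq0 mulf_neq0 ?invr_eq0 ?g0 //; exact: ltnW.
Qed.

End Factor.

(** * The functions sigma and null vectors *)

Section Sigma.
Variables (L : fieldType) (n : nat).
Implicit Types (u v : 'I_n.+1 -> L) (c : L).

Definition tau (R : nzRingType) (u v : 'I_n.+1 -> R) (r : nat) : R :=
  (\prod_(s < n.+1 | (s < r)%N) v s) * (\prod_(s < n.+1 | (r < s)%N) u s).

Lemma sigma_sum (R : nzRingType) (u v : 'I_n.+1 -> R) (c : R) j :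
  sigma u v c j = \sum_(r < n.+1) (if (r < j)%N then c else 1) * tau u v r.
Proof. by apply: eq_bigr => r _; rewrite mulrA. Qed.

Lemma sigmaS u v c (j : 'I_n.+1) :
  sigma u v c j.+1 = sigma u v c j + (c - 1) * tau u v j.
Proof.
rewrite !sigma_sum (bigD1 j) //= [X in _ = X + _](bigD1 j) //= ltnSn ltnn.
rewrite (eq_bigr (fun r : 'I_n.+1 => (if (r < j)%N then c else 1) * tau u v r)).
  ring.
by move=> r rj; rewrite ltnS leq_eqVlt val_eqE (negPf rj).
Qed.

(** Both sides are the product of the [v] up to [j] and of the [u] from [k] on. *)
Lemma tauS u v (j k : 'I_n.+1) : k = j.+1 :> nat ->
  tau u v j * v j = tau u v k * u k.
Proof.
move=> kj; rewrite /tau [X in _ = X * _ * _](bigD1 j) ?kj //=.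
rewrite [X in _ * X * _](bigD1 k) ?kj //=.
rewrite [X in _ = _ * X * _ * _](eq_bigl (fun s : 'I_n.+1 => (s < j)%N)).
  rewrite [X in _ * (_ * X) * _](eq_bigl (fun s : 'I_n.+1 => (j.+1 < s)%N)).
    ring.
  by move=> s; rewrite -val_eqE /= kj [(j.+1 < s)%N]ltn_neqAle eq_sym andbC.
by move=> s; rewrite -val_eqE /= ltnS andbC -ltn_neqAle.
Qed.

Lemma Wrow2E (u v : 'rV[L]_n.+1) a b : (Wrow u *m Wrow v) a b =
  if a == b then u 0 a * v 0 a
  else if val a == (val b).+1 then u 0 a + v 0 b else (val a == (val b).+2)%:R.
Proof.
rewrite Wrow_mulE mxE -val_eqE; case Ea: (val a) => [|a'] /=.
  by rewrite addr0; case: eqP => // _; rewrite mulr0.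
have an : (a' < n.+1)%N by rewrite -Ea ltnW ?ltn_ord.
rewrite mxE -val_eqE /= inordK // !eqSS.
have [e|_] := eqVneq a'.+1 b.
  by rewrite -e !ltn_eqF ?addr0 // ltnW.
have [e|_] := eqVneq a' b.
  by rewrite mulr1; congr (_ + v _ _); apply: val_inj; rewrite /= inordK.
by rewrite mulr0 add0r; case: (a' == b.+1).
Qed.

(** On the diagonal the ratios of [sg] cancel. Just below it, by [sigmaS], the two summands change
    by [(c - 1) / sg a] times [tau a * u a] and [- tau b * v b], and these cancel by [tauS]. Hence
    crystal operators preserve the product of the two factors they act on. *)
Lemma Wrow2_sigma (u v : 'rV[L]_n.+1) c
    (sg := sigma (fun j => u 0 j) (fun j => v 0 j) c) :
  (forall j, (j <= n.+1)%N -> sg j != 0) ->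
  Wrow (\row_a (sg a.+1 / sg a * u 0 a)) *m Wrow (\row_a (sg a / sg a.+1 * v 0 a))
  = Wrow u *m Wrow v.
Proof.
move=> sg0; apply/matrixP => a b; rewrite !Wrow2E !mxE.
have s0 : sg a != 0 by apply: sg0; exact: ltnW.
have s1 : sg a.+1 != 0 by apply: sg0.
case: eqP => _; first by field; apply/andP.
case: eqP => // eab.
have e1 := sigmaS (fun j => u 0 j) (fun j => v 0 j) c a.
have e2 := sigmaS (fun j => u 0 j) (fun j => v 0 j) c b.
have e3 := tauS (fun j => u 0 j) (fun j => v 0 j) eab.
rewrite -/sg in e1 e2; rewrite -eab in e2 *.
have {}e2 : sg b = sg a - (c - 1) * tau (fun j => u 0 j) (fun j => v 0 j) b.
  by rewrite e2 addrK.
rewrite e1 e2; move: (tau _ _ a) (tau _ _ b) e3 => ta tb e3.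
transitivity (u 0 a + v 0 b + (c - 1) / sg a * (ta * u 0 a - tb * v 0 b)).
  by field.
by rewrite e3 subrr mulr0 addr0.
Qed.

Section Darboux.
Variables (g g' h : nat -> L).
Hypotheses (g0 : nonzero n g) (g'0 : nonzero n g') (h0 : nonzero n h).
Hypothesis hE : forall k, (k < n.+1)%N ->
  h k = - (g' k * - (g k.+1 / g k) + g' k.+1).
Let rho k := g' k / g k.

Lemma prod_yrow (f : nat -> L) r : nonzero n f -> (r <= n.+1)%N ->
  \prod_(s < n.+1 | (s < r)%N) yrow n f 0 s = (-1) ^+ r * f r / f 0%N.
Proof.
move=> f0; elim: r => [|r IH] rn.
  by rewrite big_pred0 // expr0 mul1r divff // f0.
rewrite (bigD1 (Ordinal rn)) //=.
rewrite (eq_bigl (fun s : 'I_n.+1 => (s < r)%N)) ?IH 1?ltnW //.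
  rewrite mxE exprS /=; have h1 := f0 _ (ltnW rn); have h2 := f0 _ (leq0n _).
  by field; apply/andP.
by move=> s; rewrite -val_eqE /= ltnS andbC -ltn_neqAle.
Qed.

(** Products of entries of [yrow] telescope, and [h r] equals [g r.+1 * (rho r - rho r.+1)]. So
    [tau] is, up to a constant, a difference of consecutive values of [rho]. *)
Lemma tau_yrow r : (r < n.+1)%N ->
  tau (fun j => yrow n g 0 j) (fun j => yrow n h 0 j) r
  = (-1) ^+ n * g n.+1 / h 0%N * (rho r - rho r.+1).
Proof.
move=> rn; rewrite /tau prod_yrow //; last exact: ltnW.
have E := prod_yrow g0 rn; have := prod_yrow g0 (leqnn _).
have g1 := g0 rn; have g2 := g0 (ltnW rn); have g3 := g0 (leq0n _).
have h1 := h0 (leq0n _).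
rewrite (bigID (fun s : 'I_n.+1 => (s < r.+1)%N)) /=.
rewrite (eq_bigl (fun s : 'I_n.+1 => (s < r.+1)%N)) => [|s]; last first.
  by rewrite ltn_ord.
rewrite [X in (_ * X = _) -> _](eq_bigl (fun s : 'I_n.+1 => (r < s)%N)); last first.
  by move=> s; rewrite ltn_ord -leqNgt.
rewrite E; move: (\prod_(i < _ | _) _) => P EP.
have {EP}-> : P = (-1) ^+ n * (-1) ^+ r * g n.+1 / g r.+1.
  apply: (@mulfI _ ((-1) ^+ r.+1 * g r.+1 / g 0%N)).
    by rewrite !mulf_neq0 ?invr_eq0 // expf_neq0 // oppr_eq0 oner_neq0.
  rewrite EP !exprS; have : (-1) ^+ r * (-1) ^+ r = 1 :> L.
    by rewrite -exprMn mulrNN mulr1 expr1n.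
  move: ((-1) ^+ r) => e ee.
  transitivity (- (e * e) * (-1)^+n * g n.+1 / g 0%N); last by field; apply/andP.
  by rewrite ee; field.
rewrite hE // /rho; have : (-1) ^+ r * (-1) ^+ r = 1 :> L.
  by rewrite -exprMn mulrNN mulr1 expr1n.
move: ((-1) ^+ r) ((-1) ^+ n) => e e' ee.
transitivity ((e * e) * e' * g n.+1 / h 0%N * (g' r / g r - g' r.+1 / g r.+1)).
  by field; rewrite g1 g2.
by rewrite ee mul1r.
Qed.

(** The differences of [rho] telescope separately over [r < j], with weight [c], and over [r >= j],
    with weight 1. *)
Lemma sigma_yrow c j : (j <= n.+1)%N ->
  sigma (fun j => yrow n g 0 j) (fun j => yrow n h 0 j) c j
  = (-1) ^+ n * g n.+1 / h 0%N * (c * (rho 0 - rho j) + (rho j - rho n.+1)).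
Proof.
move=> jn; rewrite sigma_sum.
rewrite (eq_bigr (fun r : 'I_n.+1 => (-1) ^+ n * g n.+1 / h 0%N *
   ((if (r < j)%N then c else 1) * (rho r - rho r.+1)))) => [|r _]; last first.
  by rewrite tau_yrow // mulrCA.
rewrite -mulr_sumr; congr (_ * _).
rewrite -(big_mkord xpredT (fun r => (if (r < j)%N then c else 1) * (rho r - rho r.+1))).
rewrite (big_cat_nat (n := j)) //=; congr (_ + _).
  rewrite (eq_big_nat _ _ (F2 := fun r => - c * (rho r.+1 - rho r))).
    by rewrite -mulr_sumr telescope_sumr //; ring.
  by move=> r /andP[_ ->]; ring.
rewrite (eq_big_nat _ _ (F2 := fun r => - 1 * (rho r.+1 - rho r))).
  by rewrite -mulr_sumr telescope_sumr //; ring.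
by move=> r /andP[jr _]; rewrite ltnNge jr /=; ring.
Qed.

(* The parameter [rho n.+1 / rho 0] makes [sigma] proportional to [rho]. *)
Lemma sigma_darboux j : (j <= n.+1)%N ->
  sigma (fun j => yrow n g 0 j) (fun j => yrow n h 0 j) (rho n.+1 / rho 0) j
  = (-1) ^+ n * g n.+1 / h 0%N * (1 - rho n.+1 / rho 0) * rho j.
Proof.
move=> jn; rewrite sigma_yrow // /rho.
have h1 := g0 (leq0n _); have h2 := g'0 (leq0n _); have h3 := g0 jn.
have h4 := g0 (leqnn _); have h5 := h0 (leq0n _).
by field; rewrite h1 h2 h3 h4 h5.
Qed.

Hypothesis rho_neq : rho n.+1 != rho 0.

Lemma sigma_darboux_neq0 j : (j <= n.+1)%N ->
  sigma (fun j => yrow n g 0 j) (fun j => yrow n h 0 j) (rho n.+1 / rho 0) j != 0.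
Proof.
move=> jn; have r0 k : (k <= n.+1)%N -> rho k != 0.
  by move=> kn; rewrite mulf_neq0 ?invr_eq0 ?g0 ?g'0.
rewrite sigma_darboux // !mulf_neq0 ?invr_eq0 ?expf_neq0 ?oppr_eq0 ?oner_neq0 ?g0 ?h0 ?g'0 //.
by rewrite subr_eq0 eq_sym -(inj_eq (mulIf (r0 0 isT))) divfK ?r0 // mul1r.
Qed.

(** The ratio of the two [sg] is [rho a.+1 / rho a], which exchanges the ratio of consecutive
    entries of [g] for that of [g']. *)
Lemma sigma_darboux_row (a : 'I_n.+1)
    (sg := sigma (fun j => yrow n g 0 j) (fun j => yrow n h 0 j) (rho n.+1 / rho 0)) :
  sg a.+1 / sg a * yrow n g 0 a = yrow n g' 0 a.
Proof.
have := sigma_darboux_neq0 (ltnW (ltn_ord a)).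
rewrite /sg !sigma_darboux //; last exact: ltnW.
move: (_ * (1 - _)) => C; rewrite mulf_eq0 negb_or => /andP[C0 r0].
rewrite -mulf_div divff // mul1r !mxE /rho.
have h1 := g0 (ltn_ord a); have h2 := g0 (ltnW (ltn_ord a)).
have h3 := g'0 (ltnW (ltn_ord a)).
by field; rewrite h1 h2 h3.
Qed.

End Darboux.

End Sigma.

(** * Null vectors attached to a given first factor *)

Section Gof.
Variables (L : fieldType) (n : nat).
Implicit Types (y : 'rV[L]_n.+1) (s : seq 'rV[L]_n.+1).

(** A right inverse of [yrow] on rows without zero entries, normalized to be 1 at index 0. *)
Definition gof y k : L := \prod_(i < k) - y 0 (inord i).

Lemma gofS y k : gof y k.+1 = - (gof y k * y 0 (inord k)).
Proof. by rewrite /gof big_ord_recr /= mulrN. Qed.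

Lemma gof_nonzero y : (forall a, y 0 a != 0) -> nonzero n (gof y).
Proof. by move=> y0 j _; apply/prodf_neq0 => i _; rewrite oppr_eq0. Qed.

Lemma yrow_gof y : (forall a, y 0 a != 0) -> yrow n (gof y) = y.
Proof.
move=> y0; apply/rowP => a; rewrite mxE gofS inord_val mulNr opprK mulrC mulKf //.
by apply: gof_nonzero => //; exact: ltnW.
Qed.

Lemma null_gof m y A : band m A -> null m.+1 (Wrow y *m A) (gof y).
Proof.
move=> bA; apply/null_Wrow_mul => // b bm.
rewrite big1 => [|k _]; first by rewrite gofS subrr subr0.
by rewrite gofS subrr oppr0 mul0r.
Qed.

Lemma Wprod_diag_neq0 s : (forall y a, y \in s -> y 0 a != 0) ->
  forall a, Wprod s a a != 0.
Proof. by move=> s0 a; rewrite Wprod_diag prodf_seq_neq0; apply/allP => y /s0/=. Qed.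

End Gof.

(* The Darboux transform of the null vector g' of W(y) M: a null vector of M, up
   to its last entry, which g' leaves undetermined when it is free. *)
Definition hini (R : comNzRingType) n (y : 'rV[R]_n.+1) (g' : nat -> R) k : R :=
  if (k < n.+1)%N then - (g' k * y 0 (inord k) + g' k.+1) else 1.

Definition hvec (R : comNzRingType) n m (M : 'M[R]_n.+1) (y : 'rV[R]_n.+1)
    (g' : nat -> R) := gext m M (hini y g').

Lemma rmorph_hvec (R S : comNzRingType) (f : {rmorphism R -> S}) n m
    (M : 'M[R]_n.+1) (y : 'rV[R]_n.+1) (g' : nat -> R) k :
  f (hvec m M y g' k) = hvec m (map_mx f M) (map_mx f y) (f \o g') k.
Proof.
rewrite /hvec rmorph_gext; apply: eq_gext => j _; rewrite /= /hini.
by case: ifP => _; rewrite ?rmorph1 // rmorphN rmorphD rmorphM mxE.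
Qed.

Lemma eq_hvec (R : comNzRingType) n m (M : 'M[R]_n.+1) (y : 'rV[R]_n.+1)
    (g' g'' : nat -> R) :
  (forall j, (j <= n.+1)%N -> g' j = g'' j) ->
  hvec m M y g' =1 hvec m M y g''.
Proof.
move=> e; apply: eq_gext => k _; rewrite /hini; case: ltnP => // kn.
by rewrite !e // ltnW.
Qed.

Section Connect.
Variables (L : fieldType) (n m : nat) (g : nat -> L) (M : 'M[L]_n.+1).
Hypotheses (g0 : nonzero n g) (bM : band m.+1 M) (M0 : forall a, M a a != 0).
Let T := Wrow (yrow n g) *m M.

(** The Darboux transform satisfies all relations of [M] except perhaps the last, so extending its
    initial values reproduces it up to index [n]. *)
Lemma hvecE g' k : null m.+2 T g' -> (k < n.+1)%N ->
  hvec m.+1 M (yrow n g) g' k = - (g' k * - (g k.+1 / g k) + g' k.+1).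
Proof.
move=> ng kn; rewrite /hvec.
have -> : - (g' k * - (g k.+1 / g k) + g' k.+1) = hini (yrow n g) g' k.
  by rewrite /hini kn mxE inordK.
have := (null_Wrow_mul (yrow n g) g' bM).1 ng => E.
apply: (@null_gext_upto _ _ n) => // b bm; rewrite -[RHS](E b) // [in X in _ + X]/hini ltnS bm.
congr (_ + _); apply: eq_bigr => i _.
by rewrite /hini (leq_trans (ltn_ord i)) // ltnW.
Qed.

(** Inverse of the Darboux transform: the recursion solves for [g' k.+1], starting from the
    arbitrary value 0. *)
Fixpoint lift_null (h : nat -> L) k : L :=
  if k is k'.+1 then - h k' - yrow n g 0 (inord k') * lift_null h k' else 0.

Lemma lift_nullE h k :
  - (lift_null h k * yrow n g 0 (inord k) + lift_null h k.+1) = h k.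
Proof. by rewrite /=; ring. Qed.

Lemma lift_null_null h : null m.+1 M h -> null m.+2 T (lift_null h).
Proof.
move=> nh; have := lift_nullE h; move: (lift_null h) => w E.
apply/null_Wrow_mul => // b bm; have := nh b (ltnW bm); rewrite -E => {2}<-.
by congr (_ + _); apply: eq_bigr => k _; rewrite E.
Qed.

Lemma hvec_neq0 j : (j <= n.+1)%N ->
  exists2 g', null m.+2 T g' & hvec m.+1 M (yrow n g) g' j != 0.
Proof.
move=> jn; have [h nh hj] := null_neq0 M0 bM (ltn0Sn m) jn.
exists (lift_null h); first exact: lift_null_null.
have := lift_nullE h; move: (lift_null h) => w wE.
have E k : (k < n.+1)%N -> hini (yrow n g) w k = h k.
  by move=> kn; rewrite /hini kn wE.
(* If [m <= n], all initial values lie in the range where [hini] gives [h]. Otherwise every index up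
   to [n.+1] is free, and entry [n.+1] has the default value 1. *)
case: (leqP m n) => mn.
  rewrite /hvec (eq_gext _ (s' := h)) ?null_gext // => k km.
  by apply: E; exact: leq_trans km _.
have jm : (j < m.+1)%N by rewrite ltnS (leq_trans jn).
rewrite /hvec gextE jm.
rewrite /hini; case: ltnP => // _; [by rewrite wE | exact: oner_neq0].
Qed.

End Connect.

Lemma meval_neq0M (L : fieldType) k (p q : {mpoly L[k]}) v :
  (p * q).@[v] != 0 -> p.@[v] != 0 /\ q.@[v] != 0.
Proof. by rewrite mevalM mulf_eq0 negb_or => /andP[]. Qed.

Lemma meval_neq0_prod (L : fieldType) k N (F : nat -> {mpoly L[k]}) v j :
  (\prod_(i < N) F i).@[v] != 0 -> (j < N)%N -> (F j).@[v] != 0.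
Proof.
by rewrite rmorph_prod /= => /prodf_neq0 H jN; apply: (H (Ordinal jN)).
Qed.

Lemma mprod_neq0 (L : fieldType) k N (F : nat -> {mpoly L[k]}) :
  (forall j, (j < N)%N -> F j != 0) -> \prod_(i < N) F i != 0.
Proof. by move=> H; apply/prodf_neq0 => j _; apply: H. Qed.

(* The first row x1 can be moved by one operation e_1^c, after a change of the
   other factors that preserves T, to the row of an almost arbitrary null vector
   of T whose initial values lie in the base field K. *)
Lemma connect (K L : fieldType) (f : {rmorphism K -> L}) n m
    (x1 x2 : 'rV[L]_n.+1) (s2 : seq 'rV[L]_n.+1) (P : {mpoly L[m.+2]})
    (T := Wprod [:: x1, x2 & s2]) :
  infinite_ring K -> size s2 = m ->
  (forall y a, y \in [:: x1, x2 & s2] -> y 0 a != 0) ->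
  sigma (fun j => x1 0 j) (fun j => x2 0 j) 1 0 != 0 -> P != 0 ->
  exists v : 'I_m.+2 -> K,
  [/\ P.@[f \o v] != 0,
      nonzero n (gext m.+2 T (fun k => f (v (inord k)))) &
      exists (z : 'rV[L]_n.+1) (s : seq 'rV[L]_n.+1) (c : L),
      let sg := sigma (fun j => x1 0 j) (fun j => z 0 j) c in
      [/\ size s = m, Wprod [:: x1, z & s] = T,
          forall j, (j <= n.+1)%N -> sg j != 0 &
          forall a : 'I_n.+1, sg a.+1 / sg a * x1 0 a
            = yrow n (gext m.+2 T (fun k => f (v (inord k)))) 0 a]].
Proof.
move=> infK sz n0 sg0 P0.
pose M := Wprod (x2 :: s2); pose g := gof x1.
have x1n a : x1 0 a != 0 by rewrite n0 ?mem_head.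
have x2n a : x2 0 a != 0 by rewrite n0 // !inE eqxx orbT.
have g0 : nonzero n g by apply: gof_nonzero.
have bT : band m.+2 T by rewrite /T -sz; apply: (@Wprod_band _ _ [:: x1, x2 & s2]).
have bM : band m.+1 M by rewrite /M -sz; apply: (@Wprod_band _ _ (x2 :: s2)).
have T0 a : T a a != 0 by apply: Wprod_diag_neq0.
have M0 a : M a a != 0.
  by apply: Wprod_diag_neq0 => y b yy; apply: n0; rewrite inE yy orbT.
have y1 : yrow n g = x1 by apply: yrow_gof.
have TE : T = Wrow (yrow n g) *m M by rewrite y1.
(* As polynomials in the initial values: the null vector of [T], its Darboux transform, and a
   difference that vanishes exactly when [rho n.+1 = rho 0], that is when [c = 1]. *)
pose G := gen_gext m.+1 T.
pose H := hvec m.+1 (map_mx (@mpolyC m.+2 L) M) (map_mx (@mpolyC m.+2 L) x1) G.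
pose Q := G n.+1 * (g 0%N)%:MP - G 0%N * (g n.+1)%:MP.
have GE g' j : null m.+2 T g' -> (j <= n.+1)%N ->
    (G j).@[fun i : 'I_m.+2 => g' i] = g' j by apply: meval_gen_gext_null.
have HE (v : 'I_m.+2 -> L) j :
    (H j).@[v] = hvec m.+1 M x1 (fun k => (G k).@[v]) j.
  rewrite /H rmorph_hvec -!map_mx_comp !map_mx_id // => a; exact: mevalC.
have G0 j : (j <= n.+1)%N -> G j != 0 by apply: gen_gext_neq0.
have H0 j : (j <= n.+1)%N -> H j != 0.
  move=> jn; have [g' ng' hj] := hvec_neq0 g bM M0 jn.
  rewrite -TE y1 in ng' hj.
  apply: contra hj => /eqP Hj; have := HE (fun i : 'I_m.+2 => g' i) j.
  rewrite Hj meval0 => ->; apply/eqP/eq_hvec => k kn; exact/esym/GE.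
have Q0 : Q != 0.
  (* A null vector of [T] is lifted from the one defining [x2]. For it, [sigma_yrow] at [c = 1] and
     [j = 0] shows that [Q] is a nonzero multiple of the value assumed nonzero in the hypothesis on
     [sigma]. *)
  pose h := gof x2.
  have h0 : nonzero n h by apply: gof_nonzero.
  have nh : null m.+1 M h by apply: null_gof; rewrite -sz; apply: Wprod_band.
  pose g' := lift_null n g h.
  have ng' : null m.+2 T g' by rewrite TE; apply: lift_null_null.
  apply: contra sg0 => /eqP Q0.
  have := mevalB (fun i : 'I_m.+2 => g' i) (G n.+1 * (g 0%N)%:MP) (G 0%N * (g n.+1)%:MP).
  rewrite -/Q Q0 meval0 !mevalM !mevalC !GE // => e.
  have := @sigma_yrow _ n g g' h g0 h0 _ 1 0 (leq0n _).
  rewrite y1 yrow_gof // => ->; last first.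
    by move=> k kn; have := lift_nullE n g h k; rewrite -/g' mxE inordK // => <-.
  rewrite subrr mulr0 add0r; apply/eqP/(mulfI (g0 _ (leq0n _))).
  rewrite mulr0; have h1 := g0 _ (leqnn _); have h2 := g0 _ (leq0n _).
  have h3 := h0 _ (leq0n _).
  transitivity (- ((-1) ^+ n / h 0%N * (g' n.+1 * g 0%N - g' 0%N * g n.+1))).
    by field; rewrite h1 h2 h3.
  by rewrite -e mulr0 oppr0.
have : P * Q * (\prod_(j < n.+2) G j * \prod_(j < n.+2) H j) != 0.
  apply: mulf_neq0; first exact: mulf_neq0.
  have PG := mprod_neq0 (G0 : forall j, (j < n.+2)%N -> G j != 0).
  have PH := mprod_neq0 (H0 : forall j, (j < n.+2)%N -> H j != 0).
  exact: mulf_neq0 PG PH.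
case/(mpoly_nonroot f infK) => v /meval_neq0M[/meval_neq0M[Pv Qv]].
case/meval_neq0M=> Gv Hv.
pose g' := gext m.+2 T (fun k => f (v (inord k))).
have G'E j : (G j).@[f \o v] = g' j by apply: meval_gen_gext.
have g'0 : nonzero n g'.
  by move=> j jn; rewrite -G'E; apply: (meval_neq0_prod Gv).
pose h := hvec m.+1 M x1 g'.
have h0 : nonzero n h.
  move=> j jn; rewrite -(_ : (H j).@[f \o v] = h j).
    exact: (meval_neq0_prod Hv).
  by apply: etrans (HE _ _) _; apply: eq_hvec => k _; exact: G'E.
have ng' : null m.+2 T g' by apply: gext_null.
have hE k : (k < n.+1)%N -> h k = - (g' k * - (g k.+1 / g k) + g' k.+1).
  by move=> kn; rewrite /h -y1 hvecE // -TE.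
have rho : g' n.+1 / g n.+1 != g' 0%N / g 0%N.
  have h1 := g0 _ (leqnn _); have h2 := g0 _ (leq0n _).
  apply: contra Qv => /eqP e; rewrite mevalB !mevalM !mevalC !G'E.
  rewrite -[g' n.+1](divfK h1) e -{2}[g' 0%N](divfK h2); apply/eqP; ring.
exists v; split=> //.
have nh : null m.+1 M h by apply: gext_null.
(* The second row becomes [yrow n h] and the later ones are factors of [peel M h]; the first row and
   the whole product stay the same. *)
have [a|s [ss s0 sE]] := factor_band (infinite_rmorph f infK) (peel_band bM nh h0).
  exact: peel_diag bM h0 (M0 a).
exists (yrow n h), s, (g' n.+1 / g n.+1 / (g' 0%N / g 0%N)).
split=> //.
- by rewrite -[LHS]/(Wrow x1 *m (Wrow (yrow n h) *m Wprod s)) sE peelK.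
- by move=> j jn; rewrite -{1}y1; apply: sigma_darboux_neq0.
- by move=> a; rewrite -{1 2 3}y1; apply: sigma_darboux_row.
Qed.

(** * Specialization of rational functions *)

Lemma rmorph_mmap (K : nzRingType) (R S : nzRingType) (phi : {rmorphism R -> S})
    (f : K -> R) k (h : 'I_k -> R) (p : {mpoly K[k]}) :
  phi (mmap f h p) = mmap (phi \o f) (phi \o h) p.
Proof.
rewrite /mmap rmorph_sum; apply: eq_bigr => m _; rewrite rmorphM /mmap1 rmorph_prod.
by congr (_ * _); apply: eq_bigr => i _; rewrite rmorphXn.
Qed.

Lemma eq_mmap (K R : nzRingType) (f g : K -> R) k (h h' : 'I_k -> R)
    (p : {mpoly K[k]}) :
  f =1 g -> h =1 h' -> mmap f h p = mmap g h' p.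
Proof.
move=> fg hh; apply: eq_bigr => m _; rewrite fg; congr (_ * _).
by apply: eq_bigr => i _; rewrite hh.
Qed.

(** * Rows of a matrix and products of its last factors *)

Section Rows.
Variables (m n : nat).

Definition rowsfrom (R : nzRingType) k (X : 'M[R]_(m, n)) : seq 'rV[R]_n :=
  [seq row i X | i <- drop k (enum 'I_m)].

Definition MXd (R : nzRingType) k (X : 'M[R]_(m, n)) : 'M[R]_n :=
  Wprod (rowsfrom k X).

(** Zeroing the rows from [k] on expresses independence of these rows while keeping the same set of
    variables for all [k]. *)
Definition mask (R : nzRingType) k (X : 'M[R]_(m, n)) : 'M[R]_(m, n) :=
  \matrix_(a, b) (if (a < k)%N then X a b else 0).

Definition setrow (R : nzRingType) (i : 'I_m) (X : 'M[R]_(m, n)) (y : 'rV[R]_n)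
    : 'M[R]_(m, n) := \matrix_(a, b) (if a == i then y 0 b else X a b).

Lemma size_rowsfrom (R : nzRingType) k (X : 'M[R]_(m, n)) :
  size (rowsfrom k X) = (m - k)%N.
Proof. by rewrite size_map size_drop size_enum_ord. Qed.

Lemma rowsfromS (R : nzRingType) (i : 'I_m) (X : 'M[R]_(m, n)) :
  rowsfrom i X = row i X :: rowsfrom i.+1 X.
Proof.
rewrite /rowsfrom (drop_nth i) ?size_enum_ord ?ltn_ord //=.
by congr (row _ _ :: _); apply: val_inj; rewrite /= nth_enum_ord.
Qed.

Lemma rowsfrom_size (R : nzRingType) (X : 'M[R]_(m, n)) : rowsfrom m X = [::].
Proof. by rewrite /rowsfrom drop_oversize // size_enum_ord. Qed.

Lemma nth_rowsfrom (R : nzRingType) k (X : 'M[R]_(m, n)) (i : 'I_m) y :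
  (k <= i)%N -> nth y (rowsfrom k X) (i - k) = row i X.
Proof.
move=> ki; rewrite (nth_map i) ?size_drop ?size_enum_ord ?ltn_sub2r //.
  rewrite nth_drop subnKC //; congr (row _ _).
  by apply: val_inj; rewrite /= nth_enum_ord.
exact: leq_ltn_trans ki _.
Qed.

Lemma eq_rowsfrom (R : nzRingType) k (X : 'M[R]_(m, n)) s :
  size s = (m - k)%N ->
  (forall i : 'I_m, (k <= i)%N -> row i X = nth 0 s (i - k)) -> rowsfrom k X = s.
Proof.
move=> ss H; apply: (@eq_from_nth _ 0); rewrite size_rowsfrom // => j jm.
have jk : (j + k < m)%N by rewrite addnC -ltn_subRL.
by have := @nth_rowsfrom _ k X (Ordinal jk) 0 (leq_addl _ _);
  rewrite /= addnK => ->; rewrite H ?leq_addl //= addnK.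
Qed.

Lemma mem_rowsfrom (R : nzRingType) k (X : 'M[R]_(m, n)) y :
  y \in rowsfrom k X -> exists i, y = row i X.
Proof. by case/mapP => i _ ->; exists i. Qed.

Section Map.
Variables (R S : nzRingType) (f : {rmorphism R -> S}).

Lemma map_Wrow (y : 'rV[R]_n) : map_mx f (Wrow y) = Wrow (map_mx f y).
Proof.
apply/matrixP => a b; rewrite !mxE; case: ifP => // _.
by case: ifP => _; rewrite ?rmorph1 ?rmorph0.
Qed.

Lemma map_Wprod (s : seq 'rV[R]_n) : map_mx f (Wprod s) = Wprod [seq map_mx f y | y <- s].
Proof.
elim: s => [|y s IH]; first by rewrite /Wprod /= map_mx1.
by rewrite /Wprod /= map_mxM map_Wrow -/(Wprod _) IH.
Qed.

Lemma map_MXd k (X : 'M[R]_(m, n)) : map_mx f (MXd k X) = MXd k (map_mx f X).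
Proof.
rewrite /MXd map_Wprod; congr Wprod; rewrite /rowsfrom -map_comp.
by apply: eq_map => i; rewrite /= map_row.
Qed.

Lemma map_mask k (X : 'M[R]_(m, n)) : map_mx f (mask k X) = mask k (map_mx f X).
Proof. by apply/matrixP => a b; rewrite !mxE; case: ifP; rewrite ?mxE ?rmorph0. Qed.

Lemma map_setrow i (X : 'M[R]_(m, n)) y :
  map_mx f (setrow i X y) = setrow i (map_mx f X) (map_mx f y).
Proof. by apply/matrixP => a b; rewrite !mxE; case: ifP; rewrite ?mxE. Qed.
End Map.

Definition ev2 (K R : nzRingType) (io : K -> R) (X : 'M[R]_(m, n)) (T : 'M[R]_n)
    (A : {mpoly K[m * n + n * n]}) : R :=
  mmap io (fun k => row_mx (mxvec X) (mxvec T) 0 k) A.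

Lemma rmorph_ev2 (K R S : nzRingType) (phi : {rmorphism R -> S}) (io : K -> R)
    X T A :
  phi (ev2 io X T A) = ev2 (phi \o io) (map_mx phi X) (map_mx phi T) A.
Proof.
rewrite /ev2 rmorph_mmap; apply: eq_mmap => // k /=.
by rewrite -!map_mxvec -map_row_mx [RHS]mxE.
Qed.

Lemma eq_ev2 (K R : nzRingType) (io io' : K -> R) X T A :
  io =1 io' -> ev2 io X T A = ev2 io' X T A.
Proof. by move=> e; apply: eq_mmap. Qed.

End Rows.

Lemma tofrac_neq0 (R : idomainType) (x : R) : x != 0 -> x%:F != 0.
Proof. by rewrite tofrac_eq0. Qed.

Section HasVal.
Variables (P : idomainType) (L : fieldType) (phi : {rmorphism P -> L}).

(** A relation instead of a function: [phi] extends only to the fractions having some denominator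
    that it does not kill. *)
Definition hasval (r : {fraction P}) (v : L) : Prop :=
  exists a b : P, [/\ phi b != 0, r = a%:F / b%:F & v = phi a / phi b].

Lemma tofrac_eval_neq0 (b : P) : phi b != 0 -> b%:F != 0.
Proof. by rewrite tofrac_eq0; apply: contra => /eqP ->; rewrite rmorph0. Qed.

Lemma hasval_tofrac a : hasval a%:F (phi a).
Proof. by exists a, 1; rewrite !rmorph1 oner_neq0 !divr1. Qed.

Lemma hasval_uniq r v v' : hasval r v -> hasval r v' -> v = v'.
Proof.
case=> a [b [b0 -> ->]] [c [d [d0 /eqP e ->]]].
rewrite eqr_div ?tofrac_eval_neq0 // -!tofracM tofrac_eq in e.
by apply/eqP; rewrite eqr_div // -!rmorphM (eqP e).
Qed.

Lemma hasvalD r r' v v' : hasval r v -> hasval r' v' -> hasval (r + r') (v + v').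
Proof.
case=> a [b [b0 -> ->]] [c [d [d0 -> ->]]].
exists (a * d + c * b), (b * d); rewrite !rmorphM mulf_neq0 //.
by rewrite !addf_div ?tofrac_eval_neq0 // !rmorphD !rmorphM.
Qed.

Lemma hasvalM r r' v v' : hasval r v -> hasval r' v' -> hasval (r * r') (v * v').
Proof.
case=> a [b [b0 -> ->]] [c [d [d0 -> ->]]].
by exists (a * c), (b * d); rewrite !mulf_div !rmorphM mulf_neq0.
Qed.

Lemma hasvalV r v : v != 0 -> hasval r v -> hasval r^-1 v^-1.
Proof.
move=> v0 [a [b [b0 -> e]]]; exists b, a; rewrite e !invf_div; split=> //.
by apply: contra v0 => /eqP a0; rewrite e a0 mul0r.
Qed.

Lemma hasval0 : hasval 0 0.
Proof. by have := hasval_tofrac 0; rewrite !rmorph0. Qed.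

Lemma hasval1 : hasval 1 1.
Proof. by have := hasval_tofrac 1; rewrite !rmorph1. Qed.

Lemma hasval_sum I s (Q : pred I) F G :
  (forall i, Q i -> hasval (F i) (G i)) ->
  hasval (\sum_(i <- s | Q i) F i) (\sum_(i <- s | Q i) G i).
Proof.
by move=> FG; elim/big_rec2: _ => [|i x y Qi]; [exact: hasval0|exact/hasvalD/FG].
Qed.

Lemma hasval_prod I s (Q : pred I) F G :
  (forall i, Q i -> hasval (F i) (G i)) ->
  hasval (\prod_(i <- s | Q i) F i) (\prod_(i <- s | Q i) G i).
Proof.
by move=> FG; elim/big_rec2: _ => [|i x y Qi]; [exact: hasval1|exact/hasvalM/FG].
Qed.

Lemma hasvalX r v k : hasval r v -> hasval (r ^+ k) (v ^+ k).
Proof.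
by move=> h; elim: k => [|k IH]; rewrite ?exprS; [exact: hasval1|exact: hasvalM].
Qed.

Definition hasvalmx p q (X : 'M[{fraction P}]_(p, q)) (Y : 'M[L]_(p, q)) :=
  forall i j, hasval (X i j) (Y i j).

Lemma hasval_mxvec p q (X : 'M_(p, q)) Y :
  hasvalmx X Y -> hasvalmx (mxvec X) (mxvec Y).
Proof. by move=> h i; case/mxvec_indexP => a b; rewrite ord1 !mxvecE. Qed.

Lemma hasval_sigma n (u v : 'I_n -> {fraction P}) u' v' c c' j :
  (forall i, hasval (u i) (u' i)) -> (forall i, hasval (v i) (v' i)) ->
  hasval c c' -> hasval (sigma u v c j) (sigma u' v' c' j).
Proof.
move=> hu hv hc; apply: hasval_sum => r _; apply: hasvalM; last exact: hasval_prod.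
apply: hasvalM; last exact: hasval_prod.
by case: ifP => // _; exact: hasval1.
Qed.

Lemma hasval_ecrys m n (i i' : 'I_m) c c' (X : 'M_(m, n)) (Z : 'M_(m, n)) :
  (forall j, (j <= n)%N -> sigma (fun b => Z i b) (fun b => Z i' b) c' j != 0) ->
  hasval c c' -> hasvalmx X Z -> hasvalmx (ecrys i i' c X) (ecrys i i' c' Z).
Proof.
move=> s0 hc hX a b; rewrite !mxE.
have hs j : hasval (sigma (fun b => X i b) (fun b => X i' b) c j)
                   (sigma (fun b => Z i b) (fun b => Z i' b) c' j).
  exact: hasval_sigma.
have n1 : sigma (fun b => Z i b) (fun b => Z i' b) c' b != 0.
  by apply: s0; exact: ltnW.
have n2 : sigma (fun b => Z i b) (fun b => Z i' b) c' b.+1 != 0 by apply: s0.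
case: ifP => _; first by apply: hasvalM => //; apply: hasvalM => //; exact: hasvalV.
case: ifP => _ //; by apply: hasvalM => //; apply: hasvalM => //; exact: hasvalV.
Qed.

End HasVal.

(** * Products preserved by the crystal operators *)

Section EcrysInv.
Variables (L : fieldType) (m n : nat) (i i' : 'I_m) (c : L) (X : 'M[L]_(m, n.+1)).
Hypothesis ii' : i' = i.+1 :> nat.
Let sg := sigma (fun j => X i j) (fun j => X i' j) c.
Hypothesis sg0 : forall j, (j <= n.+1)%N -> sg j != 0.

Lemma ecrys_row_other a : a != i -> a != i' -> row a (ecrys i i' c X) = row a X.
Proof. by move=> ai ai'; apply/rowP => b; rewrite !mxE (negPf ai) (negPf ai'). Qed.

Lemma ecrys_row1 : row i (ecrys i i' c X) = \row_a (sg a.+1 / sg a * row i X 0 a).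
Proof. by apply/rowP => b; rewrite !mxE eqxx. Qed.

Lemma ecrys_row2 : row i' (ecrys i i' c X) = \row_a (sg a / sg a.+1 * row i' X 0 a).
Proof.
by apply/rowP => b; rewrite !mxE eqxx -val_eqE /= ii' gtn_eqF.
Qed.

Lemma MXd_ecrys k : (k <= i)%N -> MXd k (ecrys i i' c X) = MXd k X.
Proof.
move=> ki; move: {2}(i - k)%N (erefl (i - k)%N) => d.
elim: d k ki => [|d IH] k ki dk.
  have -> : k = i by apply/eqP; rewrite eqn_leq ki -subn_eq0 dk.
  rewrite /MXd !rowsfromS -ii' !rowsfromS !Wprod_cons !mulmxA.
  have -> : rowsfrom i'.+1 (ecrys i i' c X) = rowsfrom i'.+1 X.
    apply: eq_rowsfrom; first by rewrite size_rowsfrom.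
    move=> a ia; rewrite nth_rowsfrom // ecrys_row_other // -val_eqE gtn_eqF //.
    by rewrite -ltnS -ii' ltnS ltnW.
  congr (_ *m _); rewrite ecrys_row1 ecrys_row2.
  rewrite -[RHS](@Wrow2_sigma _ _ (row i X) (row i' X) c) => [|j jn].
    congr (Wrow _ *m Wrow _); apply/rowP => b; rewrite !mxE /sg /sigma;
    by do ?[congr (_ * _); do ?[congr (_ / _)]]; apply: eq_bigr => r _;
       congr (_ * _ * _); apply: eq_bigr => s _; rewrite mxE.
  have := sg0 jn; rewrite /sg /sigma; apply: contra => /eqP e; apply/eqP; rewrite -[RHS]e.
  by apply: eq_bigr => r _; congr (_ * _ * _); apply: eq_bigr => s _; rewrite mxE.
have {}ki : (k < i)%N by rewrite -subn_gt0 dk.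
have kn : (k < m)%N by apply: ltn_trans ki _.
have {dk}IH : MXd k.+1 (ecrys i i' c X) = MXd k.+1 X.
  by apply: IH; rewrite // subnS dk.
have e1 := rowsfromS (Ordinal kn) X.
have e2 := rowsfromS (Ordinal kn) (ecrys i i' c X).
rewrite /MXd in IH *; rewrite e1 e2 !Wprod_cons IH ecrys_row_other //.
  by rewrite -val_eqE /= ltn_eqF.
by rewrite -val_eqE /= ltn_eqF // ii' ltnS ltnW.
Qed.

End EcrysInv.

(** * Clearing denominators *)

Lemma split_lshift p q (i : 'I_p) : split (lshift q i) = inl i.
Proof. by rewrite -[lshift q i]/(unsplit (inl i)) unsplitK. Qed.

Lemma split_rshift p q (i : 'I_q) : split (rshift p i) = inr i.
Proof. by rewrite -[rshift p i]/(unsplit (inr i)) unsplitK. Qed.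

Section RatFun.
Variables (K : fieldType) (m n q : nat).

Let N2 := (m * n.+1 + n.+1 * n.+1)%N.

Definition pt3 (R : nzRingType) (X : 'M[R]_(m, n.+1)) (T : 'M[R]_n.+1)
    (s : 'I_q.+1 -> R) (k : 'I_(N2 + q.+1)) : R :=
  match split k with
  | inl j => row_mx (mxvec X) (mxvec T) 0 j
  | inr j => s j
  end.

Definition ev3 (R : nzRingType) (io : K -> R) X T s (A : {mpoly K[N2 + q.+1]}) : R :=
  mmap io (pt3 X T s) A.

Definition gx (R : comNzRingType) (T : 'M[R]_n.+1) (s : 'I_q.+1 -> R) :=
  gext q.+1 T (fun k => s (inord k)).

Let polK := {mpoly K[N2 + q.+1]}.
Let Xg : 'M[polK]_(m, n.+1) :=
  \matrix_(i, j) 'X_(lshift q.+1 (lshift (n.+1 * n.+1) (mxvec_index i j))).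
Let Tg : 'M[polK]_n.+1 :=
  \matrix_(i, j) 'X_(lshift q.+1 (rshift (m * n.+1) (mxvec_index i j))).
Let sg (i : 'I_q.+1) : polK := 'X_(rshift N2 i).
Let Gp j : polK := gx Tg sg j.
Let Dp : polK := \prod_(j < n.+2) Gp j.

Section Eval.
Variables (L : fieldType) (io : {rmorphism K -> L}) (X : 'M[L]_(m, n.+1))
  (T : 'M[L]_n.+1) (s : 'I_q.+1 -> L).

Lemma ev3_Xg i j : ev3 io X T s (Xg i j) = X i j.
Proof.
by rewrite mxE /ev3 mmapX mmap1U /pt3 split_lshift row_mxEl mxvecE.
Qed.

Lemma ev3_Tg i j : ev3 io X T s (Tg i j) = T i j.
Proof.
by rewrite mxE /ev3 mmapX mmap1U /pt3 split_lshift row_mxEr mxvecE.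
Qed.

Lemma ev3_sg i : ev3 io X T s (sg i) = s i.
Proof. by rewrite /ev3 mmapX mmap1U /pt3 split_rshift. Qed.

Lemma ev3_Gp j : ev3 io X T s (Gp j) = gx T s j.
Proof.
rewrite /ev3 /Gp /gx rmorph_gext.
have -> : map_mx (mmap io (pt3 X T s)) Tg = T.
  by apply/matrixP => a b; rewrite mxE -[RHS](ev3_Tg a b).
by apply: eq_gext => k _; exact: ev3_sg.
Qed.

Lemma ev3_Dp : ev3 io X T s Dp = \prod_(j < n.+2) gx T s j.
Proof. by rewrite /ev3 rmorph_prod; apply: eq_bigr => j _; exact: ev3_Gp. Qed.

Lemma ev3M A B : ev3 io X T s (A * B) = ev3 io X T s A * ev3 io X T s B.
Proof. exact: rmorphM. Qed.

Lemma ev3D A B : ev3 io X T s (A + B) = ev3 io X T s A + ev3 io X T s B.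
Proof. exact: rmorphD. Qed.

Lemma ev3Xn A k : ev3 io X T s (A ^+ k) = ev3 io X T s A ^+ k.
Proof. exact: rmorphXn. Qed.

Lemma ev3C c : ev3 io X T s c%:MP = io c.
Proof. by rewrite /ev3 mmapC. Qed.

End Eval.

Definition family := forall (L : fieldType) (io : {rmorphism K -> L})
  (X : 'M[L]_(m, n.+1)) (T : 'M[L]_n.+1) (s : 'I_q.+1 -> L), L.

(* Rational functions of (X, T, s) whose denominator is a power of the product
   of the entries of the null vector of T with initial values s. *)
Definition ratfun (F : family) : Prop :=
  exists (A : polK) (e : nat), forall (L : fieldType) (io : {rmorphism K -> L})
    (X : 'M[L]_(m, n.+1)) (T : 'M[L]_n.+1) (s : 'I_q.+1 -> L), nonzero n (gx T s) ->
  ev3 io X T s A = F L io X T s * (\prod_(j < n.+2) gx T s j) ^+ e.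

Lemma ratfun_ext (F G : family) : ratfun F ->
  (forall (L : fieldType) (io : {rmorphism K -> L})
    (X : 'M[L]_(m, n.+1)) (T : 'M[L]_n.+1) (s : 'I_q.+1 -> L),
    F L io X T s = G L io X T s) -> ratfun G.
Proof.
case=> A [e H] FG; exists A, e => L io X T s nz.
by rewrite H // FG.
Qed.

Lemma ratfunC c : ratfun (fun L io X T s => io c).
Proof.
by exists c%:MP, 0 => L io X T s _; rewrite ev3C expr0 mulr1.
Qed.

Lemma ratfunD (F G : family) : ratfun F -> ratfun G ->
  ratfun (fun L io X T s => F L io X T s + G L io X T s).
Proof.
case=> A [a HA] [B [b HB]]; exists (A * Dp ^+ b + B * Dp ^+ a), (a + b)%N.
move=> L io X T s nz; rewrite ev3D !ev3M !ev3Xn !ev3_Dp HA // HB // exprD.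
by rewrite mulrDl !mulrA [in X in _ + X]mulrAC.
Qed.

Lemma ratfunM (F G : family) : ratfun F -> ratfun G ->
  ratfun (fun L io X T s => F L io X T s * G L io X T s).
Proof.
case=> A [a HA] [B [b HB]]; exists (A * B), (a + b)%N.
by move=> L io X T s nz; rewrite ev3M HA // HB // exprD mulrACA.
Qed.

Lemma ratfunX (F : family) k : ratfun F ->
  ratfun (fun L io X T s => F L io X T s ^+ k).
Proof.
move=> rF; elim: k => [|k IH].
  by apply: ratfun_ext (ratfunC 1) _ => L io X T s; rewrite rmorph1.
by apply: ratfun_ext (ratfunM rF IH) _ => L io X T s; rewrite exprS.
Qed.

Lemma ratfunN (F : family) : ratfun F ->
  ratfun (fun L io X T s => - F L io X T s).
Proof.
move=> rF; apply: ratfun_ext (ratfunM (ratfunC (-1)) rF) _ => L io X T s.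
by rewrite rmorphN1 mulN1r.
Qed.

Lemma ratfun_sum (I : Type) (r : seq I) (F : I -> family) :
  (forall i, ratfun (F i)) ->
  ratfun (fun L io X T s => \sum_(i <- r) F i L io X T s).
Proof.
move=> rF; elim: r => [|i r IH].
  by apply: ratfun_ext (ratfunC 0) _ => L io X T s; rewrite rmorph0 big_nil.
by apply: ratfun_ext (ratfunD (rF i) IH) _ => L io X T s; rewrite big_cons.
Qed.

Lemma ratfun_prod (I : Type) (r : seq I) (F : I -> family) :
  (forall i, ratfun (F i)) ->
  ratfun (fun L io X T s => \prod_(i <- r) F i L io X T s).
Proof.
move=> rF; elim: r => [|i r IH].
  by apply: ratfun_ext (ratfunC 1) _ => L io X T s; rewrite rmorph1 big_nil.
by apply: ratfun_ext (ratfunM (rF i) IH) _ => L io X T s; rewrite big_cons.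
Qed.

Lemma ratfun_entryX i j : ratfun (fun L io X T s => X i j).
Proof. by exists (Xg i j), 0 => L io X T s _; rewrite ev3_Xg expr0 mulr1. Qed.

Lemma ratfun_entryT i j : ratfun (fun L io X T s => T i j).
Proof. by exists (Tg i j), 0 => L io X T s _; rewrite ev3_Tg expr0 mulr1. Qed.

Lemma ratfun_gx j : ratfun (fun L io X T s => gx T s j).
Proof. by exists (Gp j), 0 => L io X T s _; rewrite ev3_Gp expr0 mulr1. Qed.

Lemma ratfun_gxV j : (j < n.+2)%N -> ratfun (fun L io X T s => (gx T s j)^-1).
Proof.
move=> jn; exists (\prod_(k < n.+2 | k != Ordinal jn) Gp k), 1 => L io X T s nz.
rewrite /ev3 rmorph_prod expr1 [in RHS](bigD1 (Ordinal jn)) //= mulKf; last first.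
  exact: nz.
by apply: eq_bigr => k _; exact: ev3_Gp.
Qed.

Variable i : 'I_m.

Lemma ratfun_ev2 (A : {mpoly K[N2]}) :
  ratfun (fun L io X T s =>
    ev2 io (setrow i X (yrow n (gx T s))) (peel T (gx T s)) A).
Proof.
apply: ratfun_sum => e; apply: ratfunM; first exact: ratfunC.
apply: ratfun_prod => k; apply: ratfunX.
case: (split_ordP k) => j ->; case/mxvec_indexP: j => a b.
  have [ai|ai] := boolP (a == i).
    apply: (@ratfun_ext (fun L io X T s => - (gx T s b.+1 * (gx T s b)^-1))).
      apply/ratfunN/ratfunM; first exact: ratfun_gx.
      by apply: ratfun_gxV; exact: leqW.
    by move=> L io X T s; rewrite row_mxEl mxvecE !mxE ai.
  apply: ratfun_ext (ratfun_entryX a b) _ => L io X T s.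
  by rewrite row_mxEl mxvecE mxE (negPf ai).
apply: (@ratfun_ext (fun L io X T s =>
  - (gx T s a.+1)^-1 * \sum_(k <- index_enum 'I_a.+1) gx T s k * T (inord k) b)).
  apply: ratfunM; first by apply/ratfunN/ratfun_gxV; rewrite ltnS.
  by apply: ratfun_sum => c; apply: ratfunM; [exact: ratfun_gx|exact: ratfun_entryT].
by move=> L io X T s; rewrite row_mxEr mxvecE mxE.
Qed.

(** Both numerators carry the same power of the denominator, so their ratio is that of [A] and [B]
    at the point where row [i] and the remaining product come from the null vector with initial
    values [s]. *)
Lemma clear_denominators (A B : {mpoly K[N2]}) :
  exists (PA PB : polK) (e : nat), forall (L : fieldType) (io : {rmorphism K -> L})
    (X : 'M[L]_(m, n.+1)) (T : 'M[L]_n.+1) (s : 'I_q.+1 -> L),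
  let g := gx T s in nonzero n g ->
  ev3 io X T s PA
    = ev2 io (setrow i X (yrow n g)) (peel T g) A * (\prod_(j < n.+2) g j) ^+ e /\
  ev3 io X T s PB
    = ev2 io (setrow i X (yrow n g)) (peel T g) B * (\prod_(j < n.+2) g j) ^+ e.
Proof.
have [PA [a HA]] := ratfun_ev2 A; have [PB [b HB]] := ratfun_ev2 B.
exists (PA * Dp ^+ b), (PB * Dp ^+ a), (a + b)%N => L io X T s g nz.
rewrite !ev3M !ev3Xn !ev3_Dp HA // HB // exprD -!mulrA.
by split=> //; rewrite [in RHS](mulrC (_ ^+ a)).
Qed.

(** With constants in place of the initial values, what remains is a polynomial in the rows and the
    product only. *)
Definition freeze (v : 'I_q.+1 -> K) (A : polK) : {mpoly K[N2]} :=
  mmap (@mpolyC N2 K)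
    (fun k => match split k with inl j => 'X_j | inr j => (v j)%:MP end) A.

Lemma ev2_freeze (R : comNzRingType) (io : {rmorphism K -> R}) X T v A :
  ev2 io X T (freeze v A) = ev3 io X T (io \o v) A.
Proof.
rewrite /ev2 /freeze rmorph_mmap; apply: eq_mmap => [c|k] /=; first exact: mmapC.
by rewrite /pt3; case: split => j; rewrite ?mmapX ?mmap1U ?mmapC.
Qed.

(** Here [X] and [T] are fixed and the initial values stay indeterminate, which is the form needed
    to choose them by [mpoly_nonroot]. *)
Definition specialize (L : fieldType) (io : {rmorphism K -> L}) X T (A : polK) :
    {mpoly L[q.+1]} :=
  mmap (@mpolyC _ L \o io)
    (fun k => match split k with
      | inl j => (row_mx (mxvec X) (mxvec T) 0 j)%:MP
      | inr j => 'X_j end) A.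

Lemma meval_specialize (L : fieldType) (io : {rmorphism K -> L}) X T A v :
  (specialize io X T A).@[v] = ev3 io X T v A.
Proof.
rewrite /specialize rmorph_mmap; apply: eq_mmap => [c|k] /=; first exact: mevalC.
by rewrite /pt3; case: split => j; rewrite ?mevalC ?mevalXU.
Qed.

End RatFun.

Lemma eq_yrow (L : fieldType) n (g g' : nat -> L) :
  (forall j, (j <= n.+1)%N -> g j = g' j) -> yrow n g = yrow n g'.
Proof. by move=> e; apply/rowP => a; rewrite !mxE !e // ltnW. Qed.

Lemma eq_peel (L : fieldType) n (T : 'M[L]_n.+1) (g g' : nat -> L) :
  (forall j, (j <= n.+1)%N -> g j = g' j) -> peel T g = peel T g'.
Proof.
move=> e; apply/matrixP => a b; rewrite !mxE !e //; congr (_ * _).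
apply: eq_bigr => k _; rewrite e //.
by rewrite (leq_trans (ltnW (ltn_ord k)) (ltn_ord a)).
Qed.

(** * Rational invariants *)

Lemma CC_infinite : infinite_ring CC.
Proof.
exists (fun k => k%:R) => a b /eqP.
rewrite (_ : (a%:R == b%:R :> CC) = (a == b)); first by move/eqP.
exact: (@Num.Theory.eqr_nat (Rdefinitions.R[i])%C).
Qed.

Lemma widen_lift k (j : 'I_k) : widen_ord (leqnSn k) j = lift ord_max j.
Proof. by apply: val_inj; rewrite /= /bump leqNgt ltn_ord. Qed.

Section Evaluation.
Variables (m n : nat).

Lemma map_evX (S : comNzRingType) (io : {rmorphism CC -> S}) (X : 'M[S]_(m, n)) :
  map_mx (mmap io (fun k => mxvec X 0 k)) (xvar m n) = X.
Proof. by apply/matrixP => i j; rewrite !mxE mmapX mmap1U mxvecE. Qed.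

Definition ioPol : {rmorphism CC -> Pol m n} := @mpolyC (m * n) CC.
Definition ioFrac : {rmorphism CC -> {fraction Pol m n}} :=
  @FracField.tofrac (Pol m n) \o @mpolyC (m * n) CC.
Definition ioRatC : {rmorphism CC -> RatC m n} :=
  @FracField.tofrac (PolC m n) \o @mpolyC (m * n).+1 CC.

Definition Xgen : 'M[{fraction Pol m n}]_(m, n) :=
  map_mx (@FracField.tofrac (Pol m n)) (xvar m n).

Lemma evCE X p : evC X p = mmap ioRatC (fun k => mxvec X 0 k) p.
Proof. by []. Qed.

Lemma evCM X p q : @evC m n X (p * q) = evC X p * evC X q.
Proof. by rewrite !evCE rmorphM. Qed.

Lemma mmap_ev2 (S : comNzRingType) (io : {rmorphism CC -> S}) (X : 'M[S]_(m, n))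
    k (A : {mpoly CC[m * n + n * n]}) :
  mmap io (fun k => mxvec X 0 k)
    (ev2 (@mpolyC (m * n) CC) (mask k (xvar m n)) (MXd k (xvar m n)) A)
  = ev2 io (mask k X) (MXd k X) A.
Proof.
rewrite rmorph_ev2 map_mask map_MXd map_evX; apply: eq_ev2 => c.
exact: mmapC.
Qed.

Lemma tofrac_ev2 k (A : {mpoly CC[m * n + n * n]}) :
  (ev2 (@mpolyC (m * n) CC) (mask k (xvar m n)) (MXd k (xvar m n)) A)%:F
  = ev2 ioFrac (mask k Xgen) (MXd k Xgen) A.
Proof. by rewrite rmorph_ev2 map_mask map_MXd; apply: eq_ev2. Qed.

Section Point.
Variables (L : fieldType) (io : {rmorphism CC -> L}) (Z : 'M[L]_(m, n)) (c : L).

Definition ptC : {rmorphism PolC m n -> L} :=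
  mmap io (fun k : 'I_(m * n).+1 =>
    if unlift ord_max k is Some j then mxvec Z 0 j else c).

Lemma hasval_io a : hasval ptC (ioRatC a) (io a).
Proof. by have := hasval_tofrac ptC a%:MP; rewrite /= mmapC. Qed.

Lemma hasval_cvar : hasval ptC (cvar m n) c.
Proof.
by have := hasval_tofrac ptC ('X_ord_max); rewrite /= mmapX mmap1U unlift_none.
Qed.

Lemma hasval_xvarC : hasvalmx ptC (xvarC m n) Z.
Proof.
move=> i j; rewrite mxE.
have := hasval_tofrac ptC ('X_(widen_ord (leqnSn _) (mxvec_index i j))).
by rewrite /= mmapX mmap1U widen_lift liftK mxvecE.
Qed.

Lemma hasval_evC X Y p : hasvalmx ptC X Y ->
  hasval ptC (evC X p) (mmap io (fun k => mxvec Y 0 k) p).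
Proof.
move=> h; apply: hasval_sum => e _; apply: hasvalM; first exact: hasval_io.
by apply: hasval_prod => k _; apply: hasvalX; exact: hasval_mxvec.
Qed.

End Point.

Lemma mmap_Xgen p : mmap ioFrac (fun k => mxvec Xgen 0 k) p = p%:F.
Proof.
rewrite -map_mxvec.
transitivity ((mmap ioPol (fun k => mxvec (xvar m n) 0 k) p)%:F).
  by rewrite rmorph_mmap; apply: eq_mmap => // k; rewrite mxE.
congr (_ %:F); rewrite [RHS]mpolyE; apply: eq_bigr => e _.
rewrite -mul_mpolyC mpolyXE_id; congr (_ * _); apply: eq_bigr => k _.
by case/mxvec_indexP: k => i j; rewrite mxvecE mxE.
Qed.

Lemma evC_xvarC_neq0 q : q != 0 -> evC (xvarC m n) q != 0.
Proof.
apply: contra => /eqP q0.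
have h : hasvalmx (ptC ioFrac Xgen 0) (xvarC m n) Xgen by apply: hasval_xvarC.
have := hasval_evC q h.
rewrite q0 mmap_Xgen => h1; have := hasval_uniq h1 (hasval0 _).
by move/eqP; rewrite tofrac_eq0.
Qed.

Lemma Xgen_neq0 i j : Xgen i j != 0.
Proof.
rewrite !mxE tofrac_eq0; apply/eqP => /(congr1 (mcoeff U_(mxvec_index i j))).
by rewrite mcoeffX eqxx mcoeff0 => /eqP; rewrite oner_eq0.
Qed.

(* What invariance under the operators acting on the rows >= k forces: f is a
   rational function of the rows < k and of the product of the other factors. *)
Definition rational_tail (f : {fraction Pol m n}) k : Prop :=
  exists A B : {mpoly CC[m * n + n * n]},
  let b := ev2 (@mpolyC (m * n) CC) (mask k (xvar m n)) (MXd k (xvar m n)) B in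
  b != 0 /\ f * b%:F
    = (ev2 (@mpolyC (m * n) CC) (mask k (xvar m n)) (MXd k (xvar m n)) A)%:F.

End Evaluation.

Lemma rmorph_sigma (R S : comNzRingType) (f : {rmorphism R -> S}) n
    (u v : 'I_n -> R) c j :
  f (sigma u v c j) = sigma (f \o u) (f \o v) (f c) j.
Proof.
rewrite rmorph_sum; apply: eq_bigr => r _; rewrite !rmorphM !rmorph_prod.
by congr (_ * _ * _); case: ifP => // _; rewrite rmorph1.
Qed.

Lemma sigma_Xgen_neq0 m n (i i' : 'I_m) : i != i' ->
  sigma (fun j => Xgen m n.+1 i j) (fun j => Xgen m n.+1 i' j) 1 0 != 0.
Proof.
(* At this point row [i'] is 0 and row [i] is 1, so in [sigma] only the term [r = 0] survives, with
   value 1. *)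
move=> ii'; pose Y : 'M[CC]_(m, n.+1) := \matrix_(a, b) (a != i')%:R.
apply/eqP => s0.
have e : sigma (fun j => xvar m n.+1 i j) (fun j => xvar m n.+1 i' j) 1 0 = 0.
  apply/eqP; rewrite -tofrac_eq0 -s0 rmorph_sigma rmorph1; apply/eqP.
  by apply: eq_bigr => r _; congr (_ * _ * _); apply: eq_bigr => k _; rewrite [RHS]mxE.
have := congr1 (mmap idfun (fun k => mxvec Y 0 k)) e.
rewrite rmorph0 rmorph_sigma rmorph1 => {}e; move/eqP: e.
have YE a b : mmap idfun (fun k => mxvec Y 0 k) (xvar m n.+1 a b) = Y a b.
  by rewrite mxE mmapX mmap1U mxvecE.
rewrite /sigma (bigD1 ord0) //= [X in _ + X]big1 => [|r r0].
  rewrite addr0 big_pred0 // !mul1r big1 => [|k _]; first by rewrite oner_eq0.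
  by rewrite YE mxE ii'.
have r1 : (0 < r)%N.
  by rewrite lt0n; apply: contra r0 => /eqP r0; apply/eqP/val_inj.
rewrite [X in _ * X * _](_ : _ = 0) ?mulr0 ?mul0r //.
by rewrite (bigD1 ord0) //= YE mxE eqxx mul0r.
Qed.

Lemma frac_cross (F : fieldType) (p q b a : F) :
  q != 0 -> p / q * b = a -> p * b = q * a.
Proof. by move=> q0 <-; field. Qed.

Lemma same_ratio (F : fieldType) (p q a b p' q' a' b' : F) :
  q != 0 -> q' != 0 -> p / q = p' / q' -> p * b = q * a -> p' * b' = q' * a' ->
  a * b' = a' * b.
Proof.
move=> q0 q'0 e e1 e2.
have -> : a = p / q * b by apply: (mulfI q0); rewrite -e1; field.
have -> : a' = p' / q' * b' by apply: (mulfI q'0); rewrite -e2; field.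
by rewrite e; ring.
Qed.

Lemma cross_cancel (F : fieldType) (f a b a' b' d : F) :
  b != 0 -> f * b = a -> a * b' = a' * b -> f * (b' * d) = a' * d.
Proof.
move=> b0 <- e; apply: (mulfI b0); transitivity (f * b * b' * d); first by ring.
by rewrite e; ring.
Qed.

(** The fraction [p / q] witnessing invariance need not be [a / b]; the polynomial identity
    [p * b = q * a] transfers the invariance. The result is cross-multiplied because [evC E b] is
    not known to be nonzero. *)
Lemma inv_under_ev2 m n (f : {fraction Pol m n}) (i i' : 'I_m) k
    (A B : {mpoly CC[m * n + n * n]})
    (a := ev2 (@mpolyC (m * n) CC) (mask k (xvar m n)) (MXd k (xvar m n)) A)
    (b := ev2 (@mpolyC (m * n) CC) (mask k (xvar m n)) (MXd k (xvar m n)) B)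
    (E := ecrys i i' (cvar m n) (xvarC m n)) :
  inv_under i i' f -> f * b%:F = a%:F ->
  evC (xvarC m n) a * evC E b = evC E a * evC (xvarC m n) b.
Proof.
case=> p [q [q0 -> qE0 inv]] /(frac_cross (tofrac_neq0 q0)).
rewrite -!tofracM => /eqP; rewrite tofrac_eq => /eqP pq.
have ev (Y : 'M[RatC m n]_(m, n)) : evC Y p * evC Y b = evC Y q * evC Y a.
  exact: etrans (esym (evCM Y p b)) (etrans (congr1 (evC Y) pq) (evCM Y q a)).
have e1 := ev (xvarC m n); have e2 := ev E.
exact: same_ratio (evC_xvarC_neq0 q0) qE0 (esym inv) e1 e2.
Qed.

(** The identity of [inv_under_ev2] holds between rational functions of [x] and [c]; it can be
    evaluated wherever no [sigma] in the denominators of [e_i^c] vanishes. *)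
Lemma inv_under_point m n (f : {fraction Pol m n}) (i i' : 'I_m) k
    (A B : {mpoly CC[m * n + n * n]}) (L : fieldType) (io : {rmorphism CC -> L})
    (Z : 'M[L]_(m, n)) c (E := ecrys i i' c Z) :
  inv_under i i' f ->
  f * (ev2 (@mpolyC (m * n) CC) (mask k (xvar m n)) (MXd k (xvar m n)) B)%:F
    = (ev2 (@mpolyC (m * n) CC) (mask k (xvar m n)) (MXd k (xvar m n)) A)%:F ->
  (forall j, (j <= n)%N -> sigma (fun b => Z i b) (fun b => Z i' b) c j != 0) ->
  ev2 io (mask k Z) (MXd k Z) A * ev2 io (mask k E) (MXd k E) B
  = ev2 io (mask k E) (MXd k E) A * ev2 io (mask k Z) (MXd k Z) B.
Proof.
move=> inv fab sZ0; have e := inv_under_ev2 inv fab.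
have hX : hasvalmx (ptC io Z c) (xvarC m n) Z by apply: hasval_xvarC.
have hE := hasval_ecrys sZ0 (hasval_cvar io Z c) hX.
rewrite -(mmap_ev2 io Z k A) -(mmap_ev2 io E k B).
rewrite -(mmap_ev2 io E k A) -(mmap_ev2 io Z k B).
move: (ev2 _ _ _ A) (ev2 _ _ _ B) e => a b e.
have h1 := hasvalM (hasval_evC a hX) (hasval_evC b hE).
have h2 := hasvalM (hasval_evC a hE) (hasval_evC b hX).
by rewrite e in h1; exact: hasval_uniq h1 h2.
Qed.

(** * Eliminating one row from an invariant *)

Section Step.
Variables (m n : nat) (f : {fraction Pol m n.+1}) (i i' : 'I_m).
Hypothesis ii' : i' = i.+1 :> nat.

Let L : fieldType := {fraction Pol m n.+1}.
Let X : 'M[L]_(m, n.+1) := Xgen m n.+1.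
Let io : {rmorphism CC -> L} := ioFrac m n.+1.
Let q := (m - i'.+1)%N.
Let x1 := row i X.
Let x2 := row i' X.
Let s2 := rowsfrom i'.+1 X.

Lemma rowsfrom_step : rowsfrom i X = [:: x1, x2 & s2].
Proof. by rewrite rowsfromS -ii' rowsfromS. Qed.

Variables (z : 'rV[L]_n.+1) (s : seq 'rV[L]_n.+1).
Hypothesis ss : size s = q.

Definition Zmat : 'M[L]_(m, n.+1) :=
  \matrix_(a, b) (if (a < i)%N then X a b else nth 0 [:: x1, z & s] (a - i) 0 b).

Lemma row_Zmat_lt (a : 'I_m) : (a < i)%N -> row a Zmat = row a X.
Proof. by move=> ai; apply/rowP => b; rewrite !mxE ai. Qed.

Lemma row_Zmat_ge (a : 'I_m) :
  (i <= a)%N -> row a Zmat = nth 0 [:: x1, z & s] (a - i).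
Proof. by move=> ai; apply/rowP => b; rewrite !mxE ltnNge ai. Qed.

Lemma row_Zmat1 : row i Zmat = x1.
Proof. by rewrite row_Zmat_ge // subnn. Qed.

Lemma row_Zmat2 : row i' Zmat = z.
Proof. by rewrite row_Zmat_ge ii' ?leqnSn // subSnn. Qed.

Lemma rowsfrom_Zmat : rowsfrom i Zmat = [:: x1, z & s].
Proof.
apply: eq_rowsfrom => [|a ia]; last exact: row_Zmat_ge.
have im : (i.+1 < m)%N by rewrite -ii'.
by rewrite /= ss /q ii' !subnSK // ltnW.
Qed.

Lemma mask_Zmat : mask i.+1 Zmat = mask i.+1 X.
Proof.
apply/matrixP => a b; rewrite ![mask _ _ _ _]mxE; case: ifP => //.
rewrite ltnS leq_eqVlt => /predU1P[/val_inj ->|ai].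
  by have /rowP/(_ b) := row_Zmat1; rewrite !mxE.
by have /rowP/(_ b) := row_Zmat_lt ai; rewrite !mxE.
Qed.

Lemma mask_setrow (Y : 'M[L]_(m, n.+1)) : mask i.+1 Y
  = setrow i (mask i Y) (row i Y).
Proof.
apply/matrixP => a b; rewrite !mxE ltnS leq_eqVlt val_eqE.
by case: eqP => [->|].
Qed.

End Step.

Lemma eq_sigma (R : nzRingType) n (u u' v v' : 'I_n -> R) c j :
  u =1 u' -> v =1 v' -> sigma u v c j = sigma u' v' c j.
Proof.
move=> e e'; apply: eq_bigr => r _.
by congr (_ * _ * _); apply: eq_bigr => s _; rewrite ?e ?e'.
Qed.

(** The matrix [Z] agrees with the generic one through row [i] and in the product of the later
    factors. Applying [e_i^c] to it keeps [T] and turns row [i] into [yrow n g'], with [g']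
    determined by [T] and the constants [v]. Invariance thus rewrites [f] in terms of the rows
    before [i] and of [T]. *)
Lemma rational_tail_step m n (f : {fraction Pol m n.+1}) (i i' : 'I_m) :
  i' = i.+1 :> nat -> inv_under i i' f -> rational_tail f i.+1 -> rational_tail f i.
Proof.
move=> ii' inv [A [B [b0 fab]]].
pose X := Xgen m n.+1; pose io := ioFrac m n.+1; pose q := (m - i'.+1)%N.
pose x1 := row i X; pose x2 := row i' X; pose s2 := rowsfrom i'.+1 X.
pose T := MXd i X; pose g := gof x1.
have rX : rowsfrom i X = [:: x1, x2 & s2] by apply: rowsfrom_step.
have rX' : rowsfrom i.+1 X = x2 :: s2.
  by move: rX; rewrite rowsfromS => -[].
have TE : T = Wrow x1 *m MXd i.+1 X by rewrite /T /MXd rowsfromS Wprod_cons.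
have x0 y a : y \in [:: x1, x2 & s2] -> y 0 a != 0.
  by rewrite -rX => /mem_rowsfrom[k ->]; rewrite mxE; apply: Xgen_neq0.
have x1n a : x1 0 a != 0 by apply: x0; rewrite mem_head.
have g0 : nonzero n g by apply: gof_nonzero.
have y1 : yrow n g = x1 by apply: yrow_gof.
have sz : size s2 = q by rewrite size_rowsfrom.
have bM : band q.+1 (MXd i.+1 X).
  by rewrite /MXd rX' -sz; apply: (@Wprod_band _ _ (x2 :: s2)).
have ng : null q.+2 T g by rewrite TE; apply: null_gof.
have [PA [PB [e H]]] := clear_denominators q.+1 i A B.
pose P := specialize io (mask i X) T PB.
have P0 : P != 0.
  (* At the initial values of the null vector [g] of the row [x1] itself, [P] gives back the
     original denominator up to a nonzero factor. *)
  pose v (k : 'I_q.+2) := g k.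
  have gv j : (j <= n.+1)%N -> gx T v j = g j.
    move=> jn; apply: etrans (null_gext (ltn0Sn _) ng jn).
    by apply: eq_gext => k kq; rewrite /v inordK.
  have nz : nonzero n (gx T v) by move=> j jn; rewrite gv // g0.
  have [_] := H _ io (mask i X) T v nz.
  rewrite (eq_yrow gv) (eq_peel _ gv) y1 -mask_setrow.
  rewrite [X in peel X _]TE -y1 peel_Wrow // -tofrac_ev2 => Pv.
  have : ev3 io (mask i X) T v PB != 0.
    rewrite Pv mulf_neq0 ?tofrac_neq0 ?expf_neq0 //.
    by apply/prodf_neq0 => j _; apply: nz; exact: (ltn_ord j).
  by apply: contra => /eqP PE; rewrite -meval_specialize -/P PE meval0.
have sg0 : sigma (fun j => x1 0 j) (fun j => x2 0 j) 1 0 != 0.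
  rewrite (@eq_sigma _ _ _ (fun j => X i j) _ (fun j => X i' j)) => [|j|j];
    rewrite ?mxE //.
  by apply: sigma_Xgen_neq0; rewrite -val_eqE /= ii' ltn_eqF.
have [v [Pv nz [z [s [c [ss WT sgn rowE]]]]]] :=
  @connect _ _ io n q x1 x2 s2 P CC_infinite sz x0 sg0 P0.
have {}WT : Wprod [:: x1, z & s] = T by rewrite WT /T /MXd rX.
have T' : Wprod [:: x1, x2 & s2] = T by rewrite /T /MXd rX.
rewrite {}T' in nz rowE.
pose g' := gx T (io \o v); pose Z := Zmat i z s; pose Z' := ecrys i i' c Z.
have Zi b : Z i b = x1 0 b.
  by have /rowP/(_ b) := row_Zmat1 i z s; rewrite [LHS]mxE.
have Zi' b : Z i' b = z 0 b.
  by have /rowP/(_ b) := row_Zmat2 ii' z s; rewrite [LHS]mxE.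
have sZ j : sigma (fun b => Z i b) (fun b => Z i' b) c j
    = sigma (fun b => x1 0 b) (fun b => z 0 b) c j by apply: eq_sigma.
have sZ0 j : (j <= n.+1)%N ->
    sigma (fun b => Z i b) (fun b => Z i' b) c j != 0.
  by move=> jn; rewrite sZ; apply: sgn.
have rZ : rowsfrom i Z = [:: x1, z & s] by exact: (rowsfrom_Zmat ii' z ss).
have rZ' : rowsfrom i.+1 Z = z :: s.
  have := congr1 behead rZ; rewrite rowsfromS; exact: id.
have MZ : MXd i.+1 Z = MXd i.+1 X.
  rewrite -(peel_Wrow (MXd i.+1 X) g0) y1 -TE -WT Wprod_cons -y1 peel_Wrow //.
  by rewrite /MXd rZ'.
have mZ : mask i.+1 Z = mask i.+1 X by apply: mask_Zmat.
have rowZ' : row i Z' = yrow n g'.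
  apply/rowP => a; rewrite ecrys_row1 mxE -rowE !sZ [row i Z 0 a]mxE Zi.
  by [].
have mZ' : mask i.+1 Z' = setrow i (mask i X) (yrow n g').
  rewrite mask_setrow rowZ'; congr (setrow _ _ _).
  apply/matrixP => a b; rewrite ![mask _ _ _ _]mxE; case: ifP => // ai.
  have /rowP/(_ b) : row a Z' = row a X.
    rewrite ecrys_row_other ?row_Zmat_lt // -val_eqE /= ltn_eqF //.
    by rewrite ii' ltnS ltnW.
  by rewrite !mxE.
have MZ' : MXd i.+1 Z' = peel T g'.
  have : MXd i Z' = T by rewrite MXd_ecrys // /MXd rZ.
  by rewrite /MXd rowsfromS Wprod_cons rowZ' => <-; rewrite peel_Wrow.
(* The side of [Z] becomes the original numerator and denominator; the side of [Z'] is what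
   [clear_denominators] expresses through [PA] and [PB]. *)
have key := inv_under_point io inv fab sZ0.
rewrite -/Z' mZ MZ mZ' MZ' -!tofrac_ev2 in key.
have [HA HB] := H _ io (mask i X) T (io \o v) nz.
have Eb C : (ev2 (@mpolyC (m * n.+1) CC) (mask i (xvar m n.+1))
      (MXd i (xvar m n.+1)) (freeze v C))%:F = ev3 io (mask i X) T (io \o v) C.
  exact: etrans (tofrac_ev2 i (freeze v C)) (ev2_freeze _ _ _ _ _).
exists (freeze v PA), (freeze v PB); split.
  by move: Pv; rewrite /P meval_specialize -(Eb PB) tofrac_eq0.
have EA := etrans (Eb PA) HA; have EB := etrans (Eb PB) HB.
apply: etrans (congr1 (fun t => f * t) EB) (etrans _ (esym EA)).
exact: cross_cancel (tofrac_neq0 b0) fab key.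
Qed.

Lemma fraction_div (R : idomainType) (f : {fraction R}) :
  exists p q : R, q != 0 /\ f = p%:F / q%:F.
Proof.
elim/quotP: f => r _; exists (frac r).1, (frac r).2.
have d0 := denom_ratioP r; split=> //.
apply: (mulIf (tofrac_neq0 d0)); rewrite divfK ?tofrac_neq0 //.
unlock FracField.tofrac; rewrite -[LHS]FracField.pi_mul.
apply/eqmodP; rewrite /= FracField.equivfE /FracField.mulf.
by rewrite !numden_Ratio ?mulf_neq0 ?oner_neq0 // !mulr1 mulrC.
Qed.

Lemma frac_rel_eq (R : idomainType) (f : {fraction R}) (a a' b b' : R) :
  b = b' -> a = a' -> f * b'%:F = a'%:F -> f * b%:F = a%:F.
Proof. by move=> -> ->. Qed.

Lemma frac_rel_div (R : idomainType) (f : {fraction R}) (a b : R) :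
  b != 0 -> f * b%:F = a%:F -> f = a%:F / b%:F.
Proof. by move=> b0 <-; rewrite mulfK // tofrac_neq0. Qed.

(** * Start of the descending induction and the last row *)

Section Subst.
Variables (m n : nat).
Let N2 := (m * n + n * n)%N.

Definition Xvar2 : 'M[{mpoly CC[N2]}]_(m, n) :=
  \matrix_(i, j) 'X_(lshift (n * n) (mxvec_index i j)).
Definition Tvar2 : 'M[{mpoly CC[N2]}]_n :=
  \matrix_(i, j) 'X_(rshift (m * n) (mxvec_index i j)).

Lemma map_Xvar2 (S : comNzRingType) (io : {rmorphism CC -> S}) X T :
  map_mx (mmap io (fun k => row_mx (mxvec X) (mxvec T) 0 k)) Xvar2 = X.
Proof. by apply/matrixP => i j; rewrite !mxE mmapX mmap1U row_mxEl mxvecE. Qed.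

Lemma map_Tvar2 (S : comNzRingType) (io : {rmorphism CC -> S})
    (X : 'M[S]_(m, n)) T :
  map_mx (mmap io (fun k => row_mx (mxvec X) (mxvec T) 0 k)) Tvar2 = T.
Proof. by apply/matrixP => i j; rewrite !mxE mmapX mmap1U row_mxEr mxvecE. Qed.

(* When a single factor W(x_i) is left, x_i is the diagonal of the product. *)
Definition diag_subst (i : 'I_m) (A : {mpoly CC[N2]}) : {mpoly CC[N2]} :=
  ev2 (@mpolyC N2 CC) (setrow i Xvar2 (\row_b Tvar2 b b)) 1%:M A.

Lemma ev2_diag_subst (S : comNzRingType) (io : {rmorphism CC -> S}) X T i A :
  ev2 io X T (diag_subst i A) = ev2 io (setrow i X (\row_b T b b)) 1%:M A.
Proof.
pose phi := mmap io (fun k => row_mx (mxvec X) (mxvec T) 0 k).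
have e1 : map_mx phi Xvar2 = X by apply: map_Xvar2.
have e2 : map_mx phi Tvar2 = T by apply: map_Tvar2.
apply: etrans (rmorph_ev2 (mmap io _) _ _ _ _) _; rewrite -/phi.
rewrite map_setrow map_mx1 -/phi e1.
have -> : map_mx phi (\row_b Tvar2 b b) = \row_b T b b.
  by apply/rowP => b; rewrite mxE [in LHS]mxE [RHS]mxE -[in RHS]e2 [RHS]mxE.
by apply: eq_ev2 => c; exact: mmapC.
Qed.

Lemma rational_tail_top (f : {fraction Pol m n}) : rational_tail f m.
Proof.
have [p [q [q0 ->]]] := fraction_div f.
pose lf (p : Pol m n) : {mpoly CC[N2]} := mmap (@mpolyC N2 CC) (fun k => 'X_(lshift (n * n) k)) p.
have E r : ev2 (@mpolyC (m * n) CC) (mask m (xvar m n)) (MXd m (xvar m n)) (lf r) = r.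
  rewrite [mask _ _](_ : _ = xvar m n); last by apply/matrixP => i j; rewrite mxE ltn_ord.
  apply: etrans (rmorph_mmap (mmap (ioPol m n) _) _ _ _) _.
  rewrite [RHS]mpolyE; apply: eq_bigr => e _.
  rewrite /= mmapC -mul_mpolyC mpolyXE_id; congr (_ * _); apply: eq_bigr => k _.
  congr (_ ^+ _); rewrite /= mmapX mmap1U row_mxEl.
  by case/mxvec_indexP: k => i j; rewrite mxvecE mxE.
exists (lf p), (lf q); split; first by rewrite (E q).
exact: frac_rel_eq (E q) (E p) (divfK (tofrac_neq0 q0) _).
Qed.

End Subst.

(** No operator pairs the last row with a following one; [diag_subst] recovers this row from the
    diagonal of its own factor. *)
Lemma rational_tail_last m n (f : {fraction Pol m n.+1}) (i : 'I_m) :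
  i.+1 = m -> rational_tail f i.+1 -> rational_tail f i.
Proof.
move=> im [A [B H]]; exists (diag_subst i A), (diag_subst i B).
have E C : ev2 (@mpolyC (m * n.+1) CC) (mask i (xvar m n.+1))
    (MXd i (xvar m n.+1)) (diag_subst i C)
  = ev2 (@mpolyC (m * n.+1) CC) (mask i.+1 (xvar m n.+1))
    (MXd i.+1 (xvar m n.+1)) C.
  apply: etrans (ev2_diag_subst (ioPol m n.+1) _ _ i C) _.
  have r1 : rowsfrom i.+1 (xvar m n.+1) = [::].
    by apply: size0nil; rewrite size_rowsfrom im subnn.
  have e1 : setrow i (mask i (xvar m n.+1)) (\row_b MXd i (xvar m n.+1) b b)
      = mask i.+1 (xvar m n.+1).
    apply/matrixP => a b; rewrite [LHS]mxE [RHS]mxE ltnS leq_eqVlt val_eqE.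
    case: eqP => [->|_] /=; last by rewrite mxE.
    rewrite mxE.
    by rewrite /MXd Wprod_diag rowsfromS r1 big_seq1 !mxE.
  have e2 : 1%:M = MXd i.+1 (xvar m n.+1) by rewrite /MXd r1.
  exact: (congr2 (fun Y U => ev2 (@mpolyC (m * n.+1) CC) Y U C) e1 e2).
case: H => b0 fab; split; first by rewrite (E B).
exact: frac_rel_eq (E B) (E A) fab.
Qed.

Lemma rational_tail_all m n (f : {fraction Pol m n.+1}) k : Inv_e f -> (k <= m)%N -> rational_tail f k.
Proof.
move=> inv km; have -> : k = (m - (m - k))%N by rewrite subKn.
move: (m - k)%N (leq_subr k m) => d; elim: d => [|d IH] dm.
  by rewrite subn0; apply: rational_tail_top.
have im : (m - d.+1 < m)%N by rewrite ltn_subrL (leq_trans _ dm).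
pose i := Ordinal im; have iS : i.+1 = (m - d)%N by rewrite /= subnSK.
have {IH} := IH (ltnW dm); rewrite -iS -[(m - d.+1)%N]/(i : nat).
have [im'|] := ltnP i.+1 m.
  by apply: (@rational_tail_step _ _ _ i (Ordinal im')) => //; apply: inv.
by move=> h; apply: rational_tail_last; apply/eqP; rewrite eqn_leq h andbT.
Qed.

(** * Entries of the product as generators *)

Section Generators.
Variables (m n : nat).
Let N := size (nontriv m n).

Lemma Wprod_rows (R : nzRingType) (X : 'M[R]_(m, n)) (s : seq 'I_m) :
  foldr (fun A B => A *m B) 1%:M [seq Wmx (fun j => X i j) | i <- s]
  = Wprod [seq row i X | i <- s].
Proof.
elim: s => [|i s IH]; first by [].
rewrite /Wprod map_cons [RHS]/= -/(Wprod _) -IH; congr (_ *m _).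
by apply/matrixP => a b; rewrite !mxE; case: eqP => // _; rewrite mxE.
Qed.

Lemma Mx_MXd : Mx m n = MXd 0 (xvar m n).
Proof.
by rewrite /MXd /rowsfrom drop0; apply: Wprod_rows.
Qed.

(** The matrix [M] with an indeterminate for each nontrivial entry. The index falls outside the list
    exactly for the trivial entries, which keep their value 0 or 1. *)
Definition Tgen : 'M[{mpoly CC[N]}]_n :=
  \matrix_(a, b) (if insub (index (a, b) (nontriv m n)) is Some k then 'X_k
                  else (Mx m n a b == 1)%:R).

Lemma mem_nontriv a b :
  ((a, b) \in nontriv m n) = (Mx m n a b != 0) && (Mx m n a b != 1).
Proof.
rewrite mem_filter andb_idr // => _; apply/allpairsP.
by exists (a, b); rewrite !mem_enum.
Qed.

Lemma map_Tgen (S : comNzRingType) (io : {rmorphism CC -> S})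
    (h : 'I_N -> S) (M : 'M[S]_n) :
  (forall a b, Mx m n a b = 0 -> M a b = 0) ->
  (forall a b, Mx m n a b = 1 -> M a b = 1) ->
  (forall k : 'I_N, let ab := tnth (in_tuple (nontriv m n)) k in
     h k = M ab.1 ab.2) ->
  map_mx (mmap io h) Tgen = M.
Proof.
move=> M0 M1 Mh; apply/matrixP => a b; rewrite !mxE.
case: insubP => [k kN kE|].
  rewrite mmapX mmap1U Mh (tnth_nth (a, b)) /= kE nth_index //.
  by rewrite -index_mem.
rewrite index_mem mem_nontriv negb_and !negbK.
have [e|e] := eqVneq (Mx m n a b) 1.
  by move=> _; rewrite rmorph_nat M1.
by rewrite orbF rmorph_nat => /eqP/M0 ->.
Qed.

Lemma evg_Tgen : map_mx (mmap (ioPol m n) (@gfam m n)) Tgen = Mx m n.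
Proof. exact: map_Tgen. Qed.

Definition to_gen (A : {mpoly CC[m * n + n * n]}) : {mpoly CC[N]} :=
  ev2 (@mpolyC N CC) (0 : 'M_(m, n)) Tgen A.

Lemma evg_to_gen A : evg (to_gen A)
  = ev2 (@mpolyC (m * n) CC) (mask 0 (xvar m n)) (MXd 0 (xvar m n)) A.
Proof.
apply: etrans (rmorph_ev2 (mmap (ioPol m n) (@gfam m n)) _ _ _ _) _.
rewrite map_mx0 evg_Tgen -Mx_MXd.
have -> : mask 0 (xvar m n) = 0 by apply/matrixP => a b; rewrite !mxE.
by apply: eq_ev2 => c; exact: mmapC.
Qed.

End Generators.

Lemma Inv_e_gen_field m n (f : {fraction Pol m n.+1}) : Inv_e f -> in_gen_field f.
Proof.
move=> inv; have [A [B [b0 fab]]] := rational_tail_all inv (leq0n m).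
have EA := evg_to_gen A; have EB := evg_to_gen B.
have B0 : evg (to_gen B) != 0 by rewrite EB.
exists (to_gen A), (to_gen B); split; first exact: B0.
exact: frac_rel_div B0 (frac_rel_eq EB EA fab).
Qed.

(** * Invariance of the entries of the product *)

Section Converse.
Variables (m n : nat) (i i' : 'I_m).
Hypothesis ii' : i' = i.+1 :> nat.
Let X := xvarC m n.+1.
Let E := ecrys i i' (cvar m n.+1) X.

(** Specializing to [c = 1] removes the dependence on [j], which reduces the claim to
    [sigma_Xgen_neq0]. *)
Lemma sigma_xvarC_neq0 j : (j <= n.+1)%N ->
  sigma (fun b => X i b) (fun b => X i' b) (cvar m n.+1) j != 0.
Proof.
move=> jn; pose io := ioFrac m n.+1.
have hX : hasvalmx (ptC io (Xgen m n.+1) 1) X (Xgen m n.+1) by apply: hasval_xvarC.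
have h := hasval_sigma j (hX i) (hX i') (hasval_cvar io (Xgen m n.+1) 1).
have ne : i != i' by rewrite -val_eqE /= ii' ltn_eqF.
apply: contra (sigma_Xgen_neq0 n ne) => /eqP s0; rewrite s0 in h.
rewrite -(hasval_uniq h (hasval0 _)); apply/eqP.
by apply: eq_bigr => r _; case: ifP.
Qed.

Lemma evC_evg A : evC E (evg A) = evC X (evg A).
Proof.
apply: etrans (rmorph_mmap (mmap (ioRatC m n.+1) (fun k => mxvec E 0 k)) _ _ _) _.
apply: etrans _ (esym (rmorph_mmap (mmap (ioRatC m n.+1) (fun k => mxvec X 0 k)) _ _ _)).
apply: eq_mmap => [c|k] /=; first by apply: etrans (mmapC _ _ _) (esym (mmapC _ _ _)).
have e (Y : 'M[RatC m n.+1]_(m, n.+1)) a b :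
    mmap (ioRatC m n.+1) (fun k => mxvec Y 0 k) (Mx m n.+1 a b) = MXd 0 Y a b.
  by rewrite Mx_MXd -[in RHS](map_evX (ioRatC m n.+1) Y) -map_MXd mxE.
apply: etrans (e E _ _) (etrans _ (esym (e X _ _))).
by rewrite MXd_ecrys // => j jn; apply: sigma_xvarC_neq0.
Qed.

End Converse.

Lemma gen_field_Inv_e m n (f : {fraction Pol m n.+1}) : in_gen_field f -> Inv_e f.
Proof.
case=> A [B [B0 ->]] i i' ii'; exists (evg A), (evg B).
have EA := evC_evg ii' A; have EB := evC_evg ii' B.
have qx := evC_xvarC_neq0 B0.
split; [exact: B0 | by [] | exact: (eq_ind_r (fun t => t != 0) qx EB) |].
exact: (congr2 (fun s t => s / t) EA EB).
Qed.

(** * Leading monomials *)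

Lemma index_allpairs (S T : eqType) (s : seq S) (t : seq T) x y :
  x \in s -> y \in t ->
  index (x, y) [seq (x, y) | x <- s, y <- t] = (index x s * size t + index y t)%N.
Proof.
move=> + yt; elim: s => // z s IH; rewrite inE allpairs_cons index_cat /=.
have inj : injective (pair z : T -> S * T) by move=> ? ? [].
have [<-|zx] := eqVneq x z.
  by rewrite mem_map ?yt ?index_map // => ? ? [].
rewrite /= => xs; rewrite IH // size_map mulSn addnA ifF //.
by apply/negP => /mapP[w _ [e]]; rewrite e eqxx in zx.
Qed.

(** The numbering of the variables is row by row, so lexicographic comparison of monomials runs
    through the rows in order. *)
Lemma val_mxvec_index m n (i : 'I_m) (j : 'I_n) :
  mxvec_index i j = (i * n + j)%N :> nat.
Proof.
rewrite /mxvec_index /= /enum_rank enum_rank_in.unlock insubdK; last first.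
  by rewrite -topredE /= cardE index_mem mem_enum.
rewrite enumT unlock /= index_allpairs ?mem_enum //.
by rewrite size_enum_ord !index_enum_ord.
Qed.

Lemma eq_mxvec_index m n (i k : 'I_m) (j l : 'I_n) :
  (mxvec_index i j == mxvec_index k l) = (i == k) && (j == l).
Proof.
apply/eqP/andP => [/cast_ord_inj/enum_rank_inj[-> ->]//|[/eqP-> /eqP->]//].
Qed.

Lemma mxvec_index_lt m n (i k : 'I_m) (j l : 'I_n) :
  (mxvec_index i j < mxvec_index k l)%N -> (i <= k)%N.
Proof.
rewrite !val_mxvec_index; apply: contraLR; rewrite -!leqNgt -ltnNge => ki.
rewrite (leq_trans _ (leq_addr _ _)) //.
by rewrite (leq_trans _ (leq_mul ki (leqnn n))) // mulSn addnC leq_add2r ltnW.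
Qed.

Section Lead.
Variables (m n : nat).
Let Pol := (Pol m n.+1).

(** The product of the variables of column [a] in the rows [k] to [m - d - 1], counted from 0: the
    leading monomial of entry [(a, a - d)] in the product of the factors from [k] on. *)
Definition mu k (a : 'I_n.+1) d : 'X_{1..m * n.+1} :=
  (\sum_(i < m | (k <= i < m - d)%N) U_(mxvec_index i a))%MM.

Lemma muE k a d (i : 'I_m) (c : 'I_n.+1) :
  mu k a d (mxvec_index i c) = ((c == a) && (k <= i < m - d)%N) :> nat.
Proof.
rewrite /mu mnm_sumE; case: (boolP (k <= i < m - d)%N) => h.
  rewrite (bigD1 i) //= big1 => [|j /andP[_ ji]].
    by rewrite addn0 mnm1E eq_mxvec_index eqxx andbT eq_sym.
  by rewrite mnm1E eq_mxvec_index (negPf ji).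
rewrite andbF big1 // => j hj; rewrite mnm1E eq_mxvec_index.
by case: eqP hj h => //= -> ->.
Qed.

Lemma mdeg_mu k a d : mdeg (mu k a d) = (m - d - k)%N.
Proof.
rewrite mdeg_sum (eq_bigr (fun=> 1%N)) => [|i _]; last by rewrite mdeg1.
rewrite -(big_ord_widen_cond m (fun i => k <= i)%N (fun=> 1%N)) ?leq_subr //.
transitivity (\sum_(k <= i < m - d) 1)%N; first by rewrite big_geq_mkord.
by rewrite sum_nat_const_nat muln1.
Qed.

Lemma mu_rec (k : 'I_m) a d : (d < m - k)%N ->
  (U_(mxvec_index k a) + mu k.+1 a d)%MM = mu k a d.
Proof.
move=> dk; apply/mnmP => x; case/mxvec_indexP: x => i c.
rewrite mnmDE !muE mnm1E eq_mxvec_index [a == c]eq_sym.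
case: (eqVneq k i) dk => [->|ik] dk; last first.
  by rewrite /= add0n (ltn_neqAle k) (inj_eq val_inj) ik.
have -> : (i < i < m - d)%N = false by rewrite ltnn.
have -> : (i <= i < m - d)%N by move: dk; lia.
by rewrite andbF andbT addn0.
Qed.

(* Monomials are compared by degree, then lexicographically by rows, so the
   leading path of M_(a, b) stays in column a as long as possible. *)
Lemma mu_lt (k : 'I_m) (a a' : 'I_n.+1) d : (d.+1 < m - k)%N -> a = a'.+1 :> nat ->
  (mu k.+1 a' d < mu k a d.+1)%O.
Proof.
move=> dk aa'; apply/ltmcP; first by rewrite !mdeg_mu; lia.
exists (mxvec_index k a) => [x|]; last by rewrite !muE ltnn eqxx; lia.
case/mxvec_indexP: x => i c /[dup] h /mxvec_index_lt ik.
rewrite !muE; have [e|ne] := eqVneq (i : nat) k; last by lia.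
have -> : (k <= i < m - d.+1)%N by lia.
have -> : (k < i < m - d)%N = false by lia.
rewrite andbF; case: eqP => // ca; move: h; rewrite ca.
by have /val_inj -> := e; rewrite ltnn.
Qed.

Definition lead1 (p : Pol) mm := mlead p = mm /\ p@_mm = 1.

Lemma lead1_neq0 p mm : lead1 p mm -> p != 0.
Proof.
by case=> _; apply: contra_eqN => /eqP ->; rewrite mcoeff0 eq_sym oner_neq0.
Qed.

Lemma lead1M p q mm mm' : lead1 p mm -> lead1 q mm' -> lead1 (p * q) (mm + mm')%MM.
Proof.
move=> /[dup] /lead1_neq0 p0 [<- cp] /[dup] /lead1_neq0 q0 [<- cq].
by split; [rewrite mleadM|rewrite mleadcM cp cq mulr1].
Qed.

Lemma lead1D p q mm : lead1 p mm -> q = 0 \/ (mlead q < mm)%O -> lead1 (p + q) mm.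
Proof.
move=> [pm cp] [->|qm]; first by rewrite addr0.
split; first by rewrite mleadDl // pm.
by rewrite mcoeffD (mcoeff_gt_mlead qm) cp addr0.
Qed.

Lemma lead1X (i : 'I_m) (a : 'I_n.+1) :
  lead1 (xvar m n.+1 i a) U_(mxvec_index i a).
Proof. by rewrite mxE; split; rewrite ?mleadXm // mcoeffX eqxx. Qed.

Lemma band_MXd k : band (m - k) (MXd k (xvar m n.+1)).
Proof. by rewrite -(size_rowsfrom k (xvar m n.+1)); apply: Wprod_band. Qed.

(** Expanding along the first factor gives [x_k^a] times entry [(a, b)] of the remaining product
    plus its entry [(a - 1, b)], and the first term leads by [mu_lt]. On the outermost subdiagonal
    the first term vanishes and the entry is 1. *)
Lemma lead_MXd j : (j <= m)%N -> forall a b : 'I_n.+1, (b <= a)%N ->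
  (a - b <= j)%N -> lead1 (MXd (m - j) (xvar m n.+1) a b) (mu (m - j) a (a - b)).
Proof.
elim: j => [|j IH] jm a b ba abj.
  have ab : a = b by apply: val_inj; move: ba abj => /=; lia.
  have -> : mu (m - 0) a (a - b) = 0%MM.
    by rewrite /mu big_pred0 // => i; move: (ltn_ord i); lia.
  rewrite subn0 /MXd rowsfrom_size /Wprod /= mxE ab eqxx.
  by split; [rewrite mlead1|rewrite mcoeff1 eqxx].
have km : (m - j.+1 < m)%N by lia.
pose k := Ordinal km; have kS : k.+1 = (m - j)%N by rewrite /=; lia.
have bd := @band_MXd k.+1; have kj : (m - k.+1 = j)%N by rewrite /=; lia.
rewrite kj in bd.
rewrite -[(m - j.+1)%N]/(k : nat) /MXd rowsfromS Wprod_cons -/(MXd _ _).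
rewrite Wrow_mulE [row _ _ _ _]mxE.
case: (ltnP (a - b) j.+1) => abj'; last first.
  rewrite (band_gt bd) ?mulr0 ?add0r; last by lia.
  case Ea: (val a) => [|a']; first by move: Ea abj abj' => /=; lia.
  have {}Ea : a = a'.+1 :> nat by [].
  have a'n : (a' < n.+1)%N by move: (ltn_ord a); lia.
  rewrite (band_eq bd) ?inordK //; last by lia.
  rewrite /mu big_pred0 => [|i]; last by rewrite /=; lia.
  by split; [rewrite mlead1|rewrite mcoeff1 eqxx].
rewrite -mu_rec; last by rewrite /=; lia.
rewrite kS; apply: lead1D; first by apply: lead1M; [exact: lead1X|apply: IH; lia].
case Ea: (val a) => [|a']; first by left.
have {}Ea : a = a'.+1 :> nat by [].
have a'n : (a' < n.+1)%N by move: (ltn_ord a); lia.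
have [a'b|ba'] := ltnP a' b.
  left; rewrite kS in bd; rewrite (band_lt bd) // inordK //.
have i1 : (b <= (inord a' : 'I_n.+1))%N by rewrite inordK.
have i2 : ((inord a' : 'I_n.+1) - b <= j)%N by rewrite inordK //; lia.
right; have [-> _] := IH (ltnW jm) _ _ i1 i2; rewrite inordK //.
have -> : (a - b = (a' - b).+1)%N by lia.
rewrite -kS mu_rec; last by rewrite /=; lia.
by apply: mu_lt; rewrite ?inordK //=; lia.
Qed.

Lemma lead_Mx (a b : 'I_n.+1) : (b <= a)%N -> (a - b <= m)%N ->
  lead1 (Mx m n.+1 a b) (mu 0 a (a - b)).
Proof.
move=> ba abm; rewrite Mx_MXd; have := lead_MXd (leqnn m) ba abm.
by rewrite subnn.
Qed.

Lemma band_Mx : band m (Mx m n.+1).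
Proof. by rewrite Mx_MXd; have := @band_MXd 0; rewrite subn0. Qed.

(** Strictly inside the band the leading monomial has positive degree, so the entry is neither 0 nor
    1. *)
Lemma nontrivE (a b : 'I_n.+1) :
  ((a, b) \in nontriv m n.+1) = (b <= a < b + m)%N.
Proof.
rewrite mem_nontriv; have [ba|ab] := leqP b a; last first.
  by rewrite (band_lt band_Mx) ?eqxx.
have [abm|] := ltnP; last first.
  rewrite leq_eqVlt => /predU1P[e|lt].
    by rewrite (band_eq band_Mx) ?eqxx ?andbF.
  by rewrite (band_gt band_Mx) ?eqxx.
have abm' : (a - b <= m)%N by lia.
have [] := lead_Mx ba abm'; move: (Mx _ _ _ _) => p pm pc.
have mu0 : mu 0 a (a - b) != 0%MM by rewrite -mdeg_eq0 mdeg_mu; lia.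
by apply/andP; split; apply: contra mu0 => /eqP e; rewrite -pm e ?mlead0 ?mlead1.
Qed.

Local Notation N := (size (nontriv m n.+1)).

Definition entry (k : 'I_N) := tnth (in_tuple (nontriv m n.+1)) k.

Lemma entry_nontriv k : ((entry k).2 <= (entry k).1 < (entry k).2 + m)%N.
Proof. by rewrite -nontrivE -surjective_pairing; apply: mem_tnth. Qed.

Lemma entry_inj : injective entry.
Proof.
move=> k l /eqP; rewrite /entry !(tnth_nth (ord0, ord0)) /= nth_uniq //.
  by move/eqP/val_inj.
rewrite filter_uniq // allpairs_uniq ?enum_uniq //.
by move=> [? ?] [? ?].
Qed.

Definition muk (k : 'I_N) := mu 0 (entry k).1 ((entry k).1 - (entry k).2).

Lemma lead_gfam k : lead1 (gfam k) (muk k).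
Proof.
change (lead1 (Mx m n.+1 (entry k).1 (entry k).2) (mu 0 (entry k).1 ((entry k).1 - (entry k).2))).
by have := entry_nontriv k => h; apply: lead_Mx; lia.
Qed.

Definition mulead (e : 'X_{1..N}) : 'X_{1..m * n.+1} := (\sum_k muk k *+ e k)%MM.

Lemma muleadD e e' : mulead (e + e') = (mulead e + mulead e')%MM.
Proof.
rewrite /mulead -big_split; apply: eq_bigr => k _ /=; apply/mnmP => i.
by rewrite !(mulmnE, mnmDE) mulnDr.
Qed.

Lemma muleadE e (i : 'I_m) (c : 'I_n.+1) : mulead e (mxvec_index i c)
  = (\sum_(k | ((entry k).1 == c) && (i < m - ((entry k).1 - (entry k).2))) e k)%N.
Proof.
rewrite mnm_sumE [RHS]big_mkcond; apply: eq_bigr => k _.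
by rewrite mulmnE muE leq0n /= [c == _]eq_sym; case: (_ && _); rewrite ?mul1n ?mul0n.
Qed.

(** Row [i] is the last one met by the leading monomial of generator [k]. Any other generator in the
    same row of [M] whose leading monomial reaches [i] also reaches [i.+1]. So [e k] is a difference
    of consecutive exponents, which makes the leading monomials multiplicatively independent. *)
Lemma mulead_diff e (k : 'I_N) (i : 'I_m) :
  i = (m - ((entry k).1 - (entry k).2).+1)%N :> nat ->
  mulead e (mxvec_index i (entry k).1)
  = (e k + \sum_(l | ((entry l).1 == (entry k).1)
                     && (i.+1 < m - ((entry l).1 - (entry l).2))) e l)%N.
Proof.
move=> iE; have hk := entry_nontriv k.
rewrite muleadE (bigD1 k) /=; last by rewrite eqxx /= iE; lia.
congr (_ + _)%N; apply: eq_bigl => l; rewrite -andbA; case: eqP => //= e1.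
have hl := entry_nontriv l; have [->|lk] := eqVneq l k.
  by rewrite andbF iE; lia.
rewrite andbT; have ne : (entry l).2 != (entry k).2 :> nat.
  apply: contra lk => /eqP/val_inj e2; apply/eqP/entry_inj.
  by rewrite (surjective_pairing (entry l)) (surjective_pairing (entry k)) e1 e2.
by move: e1 => /(congr1 val) /= e1; lia.
Qed.

Lemma mulead_inj : injective mulead.
Proof.
move=> e e' ee; apply/mnmP => k.
have H i c : mulead e (mxvec_index i c) = mulead e' (mxvec_index i c) by rewrite ee.
have hk := entry_nontriv k; have km : (m - ((entry k).1 - (entry k).2).+1 < m)%N by lia.
have := H (Ordinal km) (entry k).1; rewrite !mulead_diff //=.
suff -> : (\sum_(l | ((entry l).1 == (entry k).1) &&
    ((m - ((entry k).1 - (entry k).2).+1).+1 < m - ((entry l).1 - (entry l).2))) e l =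
  \sum_(l | ((entry l).1 == (entry k).1) &&
    ((m - ((entry k).1 - (entry k).2).+1).+1 < m - ((entry l).1 - (entry l).2))) e' l)%N.
  by move/addIn.
(* If there is a next row, the sum is itself an exponent by [muleadE]; otherwise it is empty. *)
case: (ltnP (m - ((entry k).1 - (entry k).2).+1).+1 m) => im.
  by have := H (Ordinal im) (entry k).1; rewrite !muleadE.
by rewrite !big_pred0 // => l; case: eqP => //= _; lia.
Qed.

Lemma mulead_diag e (k : 'I_N) (i : 'I_m) : (entry k).1 = (entry k).2 -> i.+1 = m ->
  mulead e (mxvec_index i (entry k).1) = e k.
Proof.
move=> e1 im; rewrite mulead_diff; last by rewrite e1; lia.
by rewrite big_pred0 ?addn0 // => l; case: eqP => //= _; lia.
Qed.

Lemma lead1_prod (I : Type) (r : seq I) (F : I -> Pol) (G : I -> 'X_{1..m * n.+1}) :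
  (forall i, lead1 (F i) (G i)) ->
  lead1 (\prod_(i <- r) F i) (\big[mnm_add/0%MM]_(i <- r) G i).
Proof.
move=> H; elim: r => [|i r IH]; last by rewrite !big_cons; apply: lead1M.
by rewrite !big_nil; split; rewrite ?mlead1 // mcoeff1 eqxx.
Qed.

Lemma lead1Xn p mm k : lead1 p mm -> lead1 (p ^+ k) (mm *+ k)%MM.
Proof.
move=> H; elim: k => [|k IH]; last by rewrite exprS mulmS; apply: lead1M.
by rewrite mulm0n expr0; split; rewrite ?mlead1 // mcoeff1 eqxx.
Qed.

Lemma lead_monom e : lead1 (mmap1 (@gfam m n.+1) e) (mulead e).
Proof. by apply: lead1_prod => k; apply: lead1Xn; apply: lead_gfam. Qed.

Lemma max_seq (T : eqType) (s : seq T) (F : T -> 'X_{1..m * n.+1}) : s != [::] ->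
  exists2 x, x \in s & forall y, y \in s -> (F y <= F x)%O.
Proof.
elim: s => // x [|z s] IH _.
  by exists x => [|y]; rewrite inE // => /eqP ->.
have [//|w ws wM] := IH _; case: (leP (F x) (F w)) => xw.
  exists w; first by rewrite inE ws orbT.
  by move=> y; rewrite inE => /predU1P[->|/wM].
exists x; first exact: mem_head.
move=> y; rewrite inE => /predU1P[->//|/wM yw].
exact: le_trans yw (ltW xw).
Qed.

(** By injectivity of [mulead], distinct monomials of [A] have distinct leading monomials after
    substitution, so the largest of them cannot cancel. *)
Lemma lead_evg (A : {mpoly CC[N]}) : A != 0 ->
  exists e, [/\ e \in msupp A, mlead (evg A) = mulead e & evg A != 0].
Proof.
move=> A0; have [|e eA eM] := @max_seq _ (msupp A) mulead.
  by rewrite msupp_eq0.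
have evgE : evg A = \sum_(e <- msupp A) A@_e *: mmap1 (@gfam m n.+1) e.
  by apply: eq_bigr => x _; rewrite mul_mpolyC.
have ce : (evg A)@_(mulead e) = A@_e.
  rewrite evgE raddf_sum /= (bigD1_seq e) ?msupp_uniq //= mcoeffZ.
  have [_ ->] := lead_monom e; rewrite mulr1 big1_seq ?addr0 // => x /andP[xe xA].
  have [lx _] := lead_monom x.
  have lt : (mlead (mmap1 (@gfam m n.+1) x) < mulead e)%O.
    by rewrite lx lt_neqAle eM // andbT; apply: contra xe => /eqP/mulead_inj ->.
  by rewrite mcoeffZ (mcoeff_gt_mlead lt) mulr0.
have A1 : evg A != 0.
  apply: contraTneq eA => A1; rewrite mcoeff_msupp -ce A1 mcoeff0 eqxx //.
exists e; split=> //; apply/le_anti/andP; split.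
  rewrite evgE; apply: le_trans (mlead_sum_le _ _ _) _.
  rewrite big_seq_cond; apply: (big_ind (fun x => x <= mulead e)%O).
  - exact: le0x.
  - by move=> x y xe ye; rewrite leUx xe.
  move=> x /andP[xA _]; apply: le_trans (mleadZ_le _ _) _.
  by have [-> _] := lead_monom x; apply: eM.
by apply: msupp_le_mlead; rewrite mcoeff_msupp ce -mcoeff_msupp.
Qed.

End Lead.

Lemma alg_indep m n : gfam_alg_indep m n.+1.
Proof. by move=> A /lead_evg[e []]. Qed.

(** * Polynomial invariants *)

Lemma irreducible_factor (F : fieldType) (p : {poly F}) : (1 < size p)%N ->
  exists2 r, irreducible_poly r & r %| p.
Proof.
have [d] := ubnP (size p); elim: d p => // d IH p; rewrite ltnS => pd p1.
have [irr|nirr] := classic (irreducible_poly p); first by exists p.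
have [q [q1 qp npq]] : exists q : {poly F}, [/\ size q != 1, q %| p & ~~ (q %= p)].
  apply: NNPP => H; apply: nirr; split=> // q q1 qp.
  by case: (boolP (q %= p)) => // npq; case: H; exists q.
have p0 : p != 0 by rewrite -size_poly_eq0 -lt0n ltnW.
have q0 : q != 0 by apply: contra p0 => /eqP q0; rewrite q0 dvd0p in qp.
have lt : (size q < size p)%N.
  rewrite ltn_neqAle (dvdp_leq p0 qp) andbT; apply: contra npq => /eqP e.
  by rewrite -dvdp_size_eqp // e.
have [||r ir rq] := IH q; first exact: leq_trans lt pd.
  by have : size q != 0 by [rewrite size_poly_eq0]; lia.
by exists r => //; apply: dvdp_trans qp.
Qed.

Lemma poly_clear (R : idomainType) (p : {poly {fraction R}}) :
  exists (d : R) (q : {poly R}),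
  d != 0 /\ map_poly (@FracField.tofrac R) q = d%:F *: p.
Proof.
elim/poly_ind: p => [|p c [d [q [d0 qE]]]].
  by exists 1, 0; rewrite oner_neq0 rmorph0 scaler0.
have [a [b [b0 ->]]] := fraction_div c.
exists (d * b), (b *: q * 'X + (d * a)%:P); rewrite mulf_neq0 //; split=> //.
rewrite rmorphD rmorphM /= map_polyX map_polyC map_polyZ qE /= scalerDr.
have e : (b%:F)%:P * ((b%:F)^-1)%:P = 1 :> {poly {fraction R}}.
  by rewrite -polyCM divff // tofrac_neq0.
rewrite !tofracM -!mul_polyC !polyCM.
move: (b%:F)%:P (b%:F^-1)%:P e => B Bi e.
transitivity (d%:F%:P * B * (p * 'X) + d%:F%:P * a%:F%:P * (B * Bi)); last ring.
by rewrite e; ring.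
Qed.

Lemma ratio_cancel (R S : idomainType) (w : R -> S) (f : S) (a b a' b' r d : R) :
  (forall x y, w (x * y) = w x * w y) -> w r != 0 ->
  b' * r = d * b -> a' * r = d * a -> f * w b = w a -> f * w b' = w a'.
Proof.
move=> wM r0 eb ea fab; apply: (mulIf r0).
by rewrite -mulrA -!wM eb ea !wM -fab; ring.
Qed.

(** * Denominators free of one off-diagonal generator *)

Section OneVar.
Variables (m n : nat).
Local Notation N := (size (nontriv m n.+1)).
Variable k : 'I_N.
Local Notation R' := {mpoly CC[N.-1]}.
Local Notation Ki := {fraction R'}.

(** With its inverse [psi], identifies the polynomials in the generator [k] over the ring of the
    others with the polynomials in all generators. Factors and roots in the generator [k] then make
    sense over the fraction field [Ki]. *)
Definition chi (p : {poly R'}) : {mpoly CC[N]} :=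
  (map_poly (mmap (@mpolyC N CC) (fun j => 'X_(lift k j))) p).['X_k].

Definition psi (A : {mpoly CC[N]}) : {poly R'} :=
  mmap (polyC \o @mpolyC N.-1 CC)
    (fun j => if unlift k j is Some j' then ('X_j')%:P else 'X) A.

Lemma mmap_chi (S : comNzRingType) (io : {rmorphism CC -> S}) (h : 'I_N -> S) p :
  mmap io h (chi p)
  = (map_poly (mmap io (fun j => h (lift k j))) p).[h k].
Proof.
apply: etrans (esym (horner_map (mmap io h) _ _)) _.
rewrite /= mmapX mmap1U -map_poly_comp; congr (_.[_]); apply: eq_map_poly => c /=.
apply: etrans (rmorph_mmap (mmap io h) _ _ _) _.
apply: eq_mmap => [z|j] /=; first exact: mmapC.
by rewrite mmapX mmap1U.
Qed.

Lemma psiK A : chi (psi A) = A.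
Proof.
pose phi : {rmorphism {poly R'} -> {mpoly CC[N]}} := horner_eval 'X_k \o
  map_poly (mmap (@mpolyC N CC) (fun j => 'X_(lift k j))).
have E p : chi p = phi p by [].
apply: etrans (E _) (etrans (rmorph_mmap phi _ _ _) _).
rewrite [RHS]mpolyE; apply: eq_bigr => e _.
have -> : (phi \o (polyC \o mpolyC N.-1 (R:=CC))) A@_e = (A@_e)%:MP.
  by rewrite /= /horner_eval /= map_polyC hornerC /= mmapC.
rewrite mul_mpolyC mpolyXE_id; congr (_ *: _); apply: eq_bigr => j _.
congr (_ ^+ _); rewrite /= /horner_eval /=; case: unliftP => [j' ->|->].
  by rewrite map_polyC hornerC /= mmapX mmap1U.
by rewrite map_polyX hornerX.
Qed.

Lemma chiK p : psi (chi p) = p.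
Proof.
rewrite /psi (mmap_chi (polyC \o @mpolyC N.-1 CC)) unlift_none.
rewrite -[RHS]comp_polyXr /comp_poly; congr (_.[_]); apply: eq_map_poly => c /=.
rewrite [in RHS](mpolyE c) raddf_sum /=; apply: eq_bigr => e _.
rewrite -mul_mpolyC polyCM /=; congr (_ * _).
rewrite mpolyXE_id rmorph_prod; apply: eq_bigr => j _.
by rewrite liftK rmorphXn.
Qed.

Lemma chi_neq0 p : p != 0 -> chi p != 0.
Proof. by apply: contra => /eqP e; rewrite -[p]chiK e /psi raddf0. Qed.

Lemma chiM p q : chi (p * q) = chi p * chi q.
Proof. by rewrite /chi rmorphM hornerM. Qed.

Lemma evgM A B : @evg m n.+1 (A * B) = evg A * evg B.
Proof. exact: (rmorphM (mmap (ioPol m n.+1) _)). Qed.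

Lemma evg_chi_neq0 p : p != 0 -> evg (chi p) != 0.
Proof. by move/chi_neq0/alg_indep. Qed.

Lemma evg_chiM p q : evg (chi (p * q)) = evg (chi p) * evg (chi q).
Proof. by rewrite chiM evgM. Qed.

Lemma msupp_chiC (c : R') e : e \in msupp (chi c%:P) -> e k = 0%N.
Proof.
rewrite /chi map_polyC hornerC /= => /msupp_sum_le /flatten_mapP[x _].
rewrite mul_mpolyC => /msuppZ_le.
have -> : mmap1 (fun j => 'X_(lift k j)) x
    = 'X_[(\sum_j U_(lift k j) *+ x j)%MM] :> {mpoly CC[N]}.
  by rewrite -mprodXnE.
rewrite msuppX inE => /eqP ->; rewrite mnm_sumE big1 // => j _.
by rewrite mulmnE mnm1E eq_sym (negPf (neq_lift _ _)).
Qed.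

Hypothesis m0 : (0 < m)%N.
Hypothesis kdiag : (entry k).1 != (entry k).2.

Variable f : Pol m n.+1.
Local Notation rel a b := (f * evg (chi b) = evg (chi a)).
Local Notation tf := (map_poly (@FracField.tofrac R')).

Lemma mmap_tofrac (c : R') :
  mmap (@FracField.tofrac R' \o @mpolyC N.-1 CC) (fun j => ('X_j)%:F) c = c%:F.
Proof.
rewrite [in RHS](mpolyE c) raddf_sum; apply: eq_bigr => e _ /=.
rewrite -mul_mpolyC tofracM; congr (_ * _).
rewrite mpolyXE_id rmorph_prod; apply: eq_bigr => j _.
by rewrite rmorphXn.
Qed.

(* Every root of the denominator is a root of the numerator, because the
   generic point with this value of the entry k is a product of W-matrices. *)
Lemma common_factor (a b : {poly R'}) r :
  rel a b -> irreducible_poly r -> r %| tf b -> r %| tf a.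
Proof.
move=> fab ir rb; have [L _ [th rth _]] := irredp_FAdjoin ir.
pose al : {rmorphism Ki -> L} := in_alg L.
pose io : {rmorphism CC -> L} := al \o (@FracField.tofrac R' \o @mpolyC N.-1 CC).
pose h (j : 'I_N) : L := if unlift k j is Some j' then al ('X_j')%:F else th.
have hk : h k = th by rewrite /h unlift_none.
have hl j : h (lift k j) = al ('X_j)%:F by rewrite /h liftK.
have ev p : mmap io h (chi p) = (map_poly al (tf p)).[th].
  rewrite mmap_chi hk -map_poly_comp; congr (_.[_]); apply: eq_map_poly => c /=.
  rewrite -(mmap_tofrac c) [RHS](rmorph_mmap al).
  by apply: eq_mmap => // j; apply: hl.
pose T0 := map_mx (mmap io h) (Tgen m n.+1).
have T0E a' b' : T0 a' b' = if insub (index (a', b') (nontriv m n.+1)) is Some j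
    then h j else (Mx m n.+1 a' b' == 1)%:R.
  by rewrite !mxE; case: insubP => [j _ _|_]; rewrite ?mmapX ?mmap1U ?rmorph_nat.
have T0triv a' b' : (a', b') \notin nontriv m n.+1 ->
    T0 a' b' = (Mx m n.+1 a' b' == 1)%:R.
  by move=> nt; rewrite T0E insubF // index_mem (negPf nt).
have bT : band m T0.
  move=> a' b'; split=> H; rewrite T0triv ?nontrivE; try by lia.
  - by rewrite (band_lt (@band_Mx m n)) // eq_sym oner_eq0.
  - by rewrite (band_eq (@band_Mx m n)) // eqxx.
  - by rewrite (band_gt (@band_Mx m n)) // eq_sym oner_eq0.
(* The root [th], which may be zero, sits off the diagonal by [kdiag], so the diagonal entries
   remain indeterminates. *)
have T00 a' : T0 a' a' != 0.
  have aa : (a', a') \in nontriv m n.+1 by rewrite nontrivE; lia.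
  rewrite T0E insubT; first by rewrite index_mem.
  move=> lt; rewrite /h; case: unliftP => [j' _|e].
    rewrite fmorph_eq0 tofrac_eq0; apply/eqP => /(congr1 (mcoeff U_(j'))).
    by rewrite mcoeffX eqxx mcoeff0 => /eqP; rewrite oner_eq0.
  case/eqP: kdiag; rewrite -e /entry (tnth_nth (a', a')) /= nth_index //.
have infL := infinite_rmorph io CC_infinite.
have [s [ss s0 sT]] := factor_band infL bT T00.
pose X0 : 'M[L]_(m, n.+1) := \matrix_(i, j) nth 0 s i 0 j.
have MX0 : MXd 0 X0 = T0.
  rewrite -sT /MXd; congr Wprod; apply: eq_rowsfrom; first by rewrite ss subn0.
  by move=> i _; rewrite subn0; apply/rowP => j; rewrite !mxE.
pose phi : {rmorphism Pol m n.+1 -> L} := mmap io (fun i => mxvec X0 0 i).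
have phig C : phi (evg C) = mmap io h C.
  apply: etrans (rmorph_mmap phi _ _ _) _; apply: eq_mmap => [c|j] /=.
    exact: mmapC.
  have e a' b' : phi (Mx m n.+1 a' b') = T0 a' b'.
    by rewrite -MX0 -[in RHS](map_evX io X0) -map_MXd -Mx_MXd [RHS]mxE.
  rewrite /gfam /= e T0E -/(entry j).
  have jN : (index (entry j) (nontriv m n.+1) = j)%N.
    rewrite /entry (tnth_nth (ord0, ord0)) /= index_uniq //.
    rewrite filter_uniq // allpairs_uniq ?enum_uniq // => -[? ?] [? ?] //.
  by rewrite -surjective_pairing jN valK.
have e : phi f * phi (evg (chi b)) = phi (evg (chi a)).
  exact: etrans (esym (rmorphM phi _ _)) (congr1 phi fab).
have eb := etrans (phig (chi b)) (ev b); have ea := etrans (phig (chi a)) (ev a).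
have := etrans (congr1 (fun t => phi f * t) (esym eb)) (etrans e ea).
move: (phi f) => phif.
have -> : (map_poly al (tf b)).[th] = 0.
  by apply/eqP; rewrite -[_ == 0]/(root _ _); apply: root_dvdp rth; rewrite dvdp_map.
(* Otherwise the irreducible [r] would be coprime to [tf a], and a Bezout relation evaluated at the
   common root [th] would read [0 = 1]. *)
rewrite mulr0 => a0; apply: contraT; rewrite -(irreducible_poly_coprime _ ir).
case/Bezout_eq1_coprimepP => -[u v] /= uv.
have := congr1 (fun p => (map_poly al p).[th]) uv.
rewrite rmorphD !rmorphM rmorph1 !hornerE -a0 mulr0 addr0.
by move/rootP: rth => ->; rewrite mulr0 => /eqP; rewrite eq_sym oner_eq0.
Qed.

Lemma tf_inj : injective tf.
Proof. by apply: map_inj_poly; rewrite ?rmorph0 // => x y /eqP; rewrite tofrac_eq => /eqP. Qed.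

Lemma size_tf p : size (tf p) = size p.
Proof. by apply: size_map_inj_poly; rewrite ?rmorph0 // => x y /eqP; rewrite tofrac_eq => /eqP. Qed.

(** Induction on the degree of [b] in the generator [k]. An irreducible factor of [b] over the
    fraction field also divides [a] by [common_factor]; it is cancelled after [d1], [d2] and [d3]
    clear the denominators of the coefficients. *)
Lemma denominator_free (a b : {poly R'}) : b != 0 -> rel a b ->
  exists a' (c : R'), c != 0 /\ rel a' c%:P.
Proof.
have [d] := ubnP (size b); elim: d a b => // d IH a b; rewrite ltnS => bd b0 fab.
have [b1|b1] := leqP (size b) 1.
  by exists a, b`_0; rewrite -(size1_polyC b1) -polyC_eq0 -(size1_polyC b1).
have [|r ir rb] := @irreducible_factor _ (tf b); first by rewrite size_tf.
have ra := common_factor fab ir rb.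
have [[b1' bE] [a1' aE]] := (dvdpP _ _ rb, dvdpP _ _ ra).
have [d1 [b' [d10 b'E]]] := poly_clear b1'.
have [d2 [a' [d20 a'E]]] := poly_clear a1'.
have [d3 [r' [d30 r'E]]] := poly_clear r.
have r0 : r != 0 by rewrite -size_poly_eq0; case: ir => + _; lia.
have r'0 : r' != 0.
  by rewrite -size_poly_eq0 -size_tf r'E size_scale ?tofrac_neq0 // size_poly_eq0.
have eb : (d2%:P * b') * r' = (d1 * d2 * d3)%:P * b.
  apply: tf_inj; rewrite 2!rmorphM [RHS]rmorphM /= !map_polyC /= b'E r'E bE.
  rewrite !tofracM !polyCM -!mul_polyC.
  move: (d1%:F)%:P (d2%:F)%:P (d3%:F)%:P => D1 D2 D3.
  by move: r b1' {ir rb ra r'E aE bE a'E b'E r0} => r b1'; ring.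
have ea : (d1%:P * a') * r' = (d1 * d2 * d3)%:P * a.
  apply: tf_inj; rewrite 2!rmorphM [RHS]rmorphM /= !map_polyC /= a'E r'E aE.
  rewrite !tofracM !polyCM -!mul_polyC.
  move: (d1%:F)%:P (d2%:F)%:P (d3%:F)%:P => D1 D2 D3.
  by move: r a1' {ir rb ra r'E aE bE a'E b'E r0} => r a1'; ring.
have nb' : d2%:P * b' != 0.
  have : (d1 * d2 * d3)%:P * b != 0 by rewrite !mulf_neq0 // polyC_eq0 !mulf_neq0.
  by rewrite -eb mulf_eq0 negb_or => /andP[].
have sb' : (size (d2%:P * b')%R < d)%N.
  have D0 : d1 * d2 * d3 != 0 by apply: mulf_neq0 => //; apply: mulf_neq0.
  have e1 := size_mul nb' r'0; have e2 := size_Cmul b D0.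
  have r1 : (1 < size r')%N by rewrite -size_tf r'E size_scale ?tofrac_neq0 //; case: ir.
  have e3 : size b = (size (d2%:P * b')%R + size r').-1.
    exact: etrans (esym e2) (etrans (congr1 (fun p : {poly R'} => size p) (esym eb)) e1).
  by move: e3 r1 bd {e1 e2}; move: (size _) (size r') (size b) => x y z; clear; lia.
apply: (IH _ _ sb' nb').
exact: ratio_cancel evg_chiM (evg_chi_neq0 r'0) eb ea fab.
Qed.

End OneVar.

Section PolyInvariants.
Variables (m n : nat).
Hypothesis m0 : (0 < m)%N.
Local Notation N := (size (nontriv m n.+1)).

Lemma mlead_ratio (f : Pol m n.+1) (A B : {mpoly CC[N]}) :
  f != 0 -> B != 0 -> f * evg B = evg A ->
  exists eA eB, [/\ eB \in msupp B,
    mlead (evg A) = mulead eA & (mlead f + mulead eB)%MM = mulead eA].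
Proof.
move=> f0 B0 fab; have [eB [eBB lB nB]] := lead_evg B0.
have A0 : A != 0.
  apply: contraTneq (mulf_neq0 f0 nB) => A0; rewrite negbK.
  by apply/eqP; apply: etrans fab _; rewrite A0 /evg mmap0.
have [eA [_ lA _]] := lead_evg A0; exists eA, eB; split=> //.
by rewrite -lA -lB -mleadM // fab.
Qed.

(** For a diagonal generator, its exponent is read off in the last row. For another one, a second
    representation of [f] has a denominator free of this generator; comparing leading monomials
    gives [eA + eB' = eA' + eB] by injectivity of [mulead], with [eB' k = 0]. *)
Lemma mulead_sub_le (f : Pol m n.+1) (A B : {mpoly CC[N]}) eA eB :
  f != 0 -> B != 0 -> f * evg B = evg A ->
  (mlead f + mulead eB)%MM = mulead eA -> forall k, (eB k <= eA k)%N.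
Proof.
move=> f0 B0 fab le k.
have [kd|kd] := eqVneq (entry k).1 (entry k).2.
  have im : (m.-1 < m)%N by rewrite prednK.
  have := congr1 (fun x : 'X_{1..m * n.+1} => x (mxvec_index (Ordinal im) (entry k).1)) le.
  by rewrite /= mnmDE !mulead_diag ?prednK //= => <-; exact: leq_addl.
have b0 : psi k B != 0 by apply: contra B0 => /eqP e; rewrite -(psiK k B) e /chi rmorph0 horner0.
have E C : evg (chi k (psi k C)) = evg C := congr1 (@evg m n.+1) (psiK k C).
have rel := etrans (congr1 (fun t => f * t) (E B)) (etrans fab (esym (E A))).
have [a' [c [c0 fac]]] := denominator_free m0 kd b0 rel.
have B'0 : chi k c%:P != 0 by apply: chi_neq0; rewrite polyC_eq0.
have [eA' [eB' [/msupp_chiC eB'k _ le']]] := mlead_ratio f0 B'0 fac.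
have : (eA + eB')%MM = (eA' + eB)%MM.
  apply: mulead_inj; rewrite !muleadD -le -le' -!addmA; congr (_ + _)%MM.
  exact: addmC.
move/(congr1 (fun x : 'X_{1..N} => x k)); rewrite !mnmDE eB'k addn0 => ->.
exact: leq_addl.
Qed.

(** By [mulead_sub_le] the difference [z] of exponents is truncation-free, so [mlead f] is the
    leading monomial of a monomial in the generators. Subtracting a multiple of it lowers [mlead f]
    and keeps the denominator [B], hence a well-founded induction on [mlead f]. *)
Lemma gen_field_ring (f : Pol m n.+1) (A B : {mpoly CC[N]}) :
  B != 0 -> f * evg B = evg A -> in_gen_ring f.
Proof.
move=> B0; have [mm fm] : exists mm, mlead f = mm by exists (mlead f).
elim: (ltom_wf mm) f A fm => {}mm _ IH f A fm fab.
have [->|f0] := eqVneq f 0; first by exists 0; rewrite /evg mmap0.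
have [eA [eB [_ _ le]]] := mlead_ratio f0 B0 fab.
have leAB := mulead_sub_le f0 B0 fab le.
pose z := (eA - eB)%MM.
have zE : (z + eB)%MM = eA by apply: submK; apply/mnm_lepP.
have fz : mlead f = mulead z.
  by apply: (@addIm _ (mulead eB)); rewrite le -zE muleadD.
have [lg cg] := lead_monom z.
pose g := mmap1 (@gfam m n.+1) z; pose c := mleadc f.
pose C : {mpoly CC[N]} := c%:MP * 'X_[z].
have gC : evg C = c *: g.
  by rewrite /C evgM /evg mmapC mmapX mul_mpolyC.
pose f' := f - c *: g.
have rel' : f' * evg B = evg (A - C * B).
  rewrite /f' mulrBl fab -gC -evgM /evg.
  by apply/esym/(raddfB (mmap (ioPol m n.+1) _)).
have c0 : f'@_mm = 0.
  by rewrite mcoeffB mcoeffZ -fm {2}fz cg mulr1 subrr.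
have [f'0|f'0] := eqVneq f' 0.
  by exists C; rewrite gC; apply/eqP; rewrite -subr_eq0; apply/eqP.
have lt : (mlead f' < mm)%O.
  rewrite lt_neqAle; apply/andP; split.
    by apply: contra f'0 => /eqP e; rewrite -mleadc_eq0 e c0.
  apply: le_trans (mleadB_le _ _) _; rewrite leUx fm lexx /=.
  by apply: le_trans (mleadZ_le _ _) _; rewrite lg -fz fm.
have [D f'D] := IH _ lt _ _ erefl rel'.
exists (D + C); apply: etrans (esym (raddfD (mmap (ioPol m n.+1) _) _ _)).
by apply: etrans (esym (subrK (c *: g) f)) _; rewrite -/f' f'D -gC.
Qed.

End PolyInvariants.

Theorem theorem1p1 (m n : nat) : (0 < m)%N -> (0 < n)%N ->
  [/\ gfam_alg_indep m n,
      (forall f : {fraction Pol m n}, Inv_e f <-> in_gen_field f)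
    & (forall p : Pol m n, Inv_e (p%:F) <-> in_gen_ring p)].
Proof.
move=> m0; case: n => // n _; split; first exact: alg_indep.
- by move=> f; split; [exact: Inv_e_gen_field | exact: gen_field_Inv_e].
move=> p; split=> [/Inv_e_gen_field[A [B [B0 e]]]|[A e]].
  have B1 : B != 0 by apply: contra B0 => /eqP ->; rewrite /evg mmap0.
  apply: (gen_field_ring m0 B1 (A := A)); apply/eqP.
  by rewrite -tofrac_eq tofracM e divfK // tofrac_neq0.
have e1 : evg (1 : {mpoly CC[size (nontriv m n.+1)]}) = 1.
  exact: (rmorph1 (mmap (ioPol m n.+1) _)).
apply: gen_field_Inv_e; exists A, 1; rewrite e1 oner_neq0; split=> //.
by rewrite -e tofrac1 divr1.
Qed.
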